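(* Let $G$ be a countably infinite group, let $\omega$ be a weight on $G$ which is not strongly non-amenable, and let $\mathcal A=l^1(G,\omega)$. Then $c_0(G)$ is not a left-injective Banach left $\mathcal A$-module.
   Context: Weight: $\omega:G\to(0,\infty)$, $\omega(st)\le\omega(s)\omega(t)$, $\omega(e_G)=1$; $\Omega(g,h)=\omega(gh)\omega(g)^{-1}\omega(h)^{-1}$; $l^1(G,\omega)$ is $l^1(G)$ with $\delta_g\star\delta_h=\Omega(g,h)\delta_{gh}$. $c_0(G)$ is a left submodule of $l^\infty(G)=\mathcal A'$ with $\langle a\cdot\mu,b\rangle=\mu(ba)$. The weight $\omega$ is strongly non-amenable if for every $\epsilon>0$ the set $\{g\in G:\omega(g)\omega(g^{-1})<\epsilon^{-1}\}$ is finite. A Banach left $\mathcal A$-module $E$ is left-injective if whenever $F,G$ are Banach left $\mathcal A$-modules, $\theta:F\to G$ is an injective bounded left-module homomorphism with closed complemented range, and $\sigma:F\to E$ is a bounded left-module homomorphism, there is a bounded left-module homomorphism $\rho:G\to E$ with $\rho\circ\theta=\sigma$. *)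

(* Defs.v *)
From HB Require Import structures.
From mathcomp Require Import all_boot all_order all_algebra.
From mathcomp Require Import all_classical all_reals all_analysis.
From mathcomp Require Import complex.

Set Implicit Arguments.
Unset Strict Implicit.
Unset Printing Implicit Defensive.

Import Order.TTheory GRing.Theory Num.Theory.

Local Open Scope classical_set_scope.
Local Open Scope ring_scope.

Section WeightedL1.
Variables (R : realType) (G : groupType).
Local Notation C := R[i].

Definition RtoC (x : R) : C := Complex x 0.
Definition cabs (z : C) : R := complex.Re `|z|.

(** Norm of a complex normed space, as a real number (the library norm is
    C-valued with real nonnegative values). *)
Definition nrm (V : normedModType C) (x : V) : R := complex.Re `|x|.

Definition is_weight (w : G -> R) : Prop :=
  [/\ forall g, 0 < w g,
      forall s t, w (s * t)%g <= w s * w t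
    & w 1%g = 1].

Definition Omega (w : G -> R) (g h : G) : R := w (g * h)%g / (w g * w h).

Definition strongly_non_amenable (w : G -> R) : Prop :=
  forall eps : R, 0 < eps ->
    finite_set [set g : G | w g * w (g^-1)%g < eps^-1].

Definition rsum (f : G -> R) : R :=
  fine (\esum_(g in [set: G]) (Num.max (f g) 0)%:E)
  - fine (\esum_(g in [set: G]) (Num.max (- f g) 0)%:E).

Definition csum (f : G -> C) : C :=
  Complex (rsum (fun g => complex.Re (f g))) (rsum (fun g => complex.Im (f g))).

(** Elements of l^1(G) (the underlying Banach space of l^1(G, omega)) and the norm. *)
Definition l1 (a : G -> C) : Prop :=
  (\esum_(g in [set: G]) (cabs (a g))%:E < +oo)%E.

Definition l1norm (a : G -> C) : R :=
  fine (\esum_(g in [set: G]) (cabs (a g))%:E).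

(** Point masses and the twisted product of l^1(G, omega):
    delta_g * delta_h = Omega(g,h) delta_(gh), extended bilinearly, i.e.
    (a * b)(t) = sum_(g h = t) Omega(g,h) a(g) b(h). *)
Definition delta (g : G) : G -> C := fun h => if h == g then 1 else 0.

Definition conv (w : G -> R) (a b : G -> C) : G -> C :=
  fun t => csum (fun g => RtoC (Omega w g (g^-1 * t)%g) * a g * b (g^-1 * t)%g).

Record banach_lmod (w : G -> R) := BanachLMod {
  bl_car :> completeNormedModType C;
  bl_act : (G -> C) -> bl_car -> bl_car;
  bl_act_linr : forall a, l1 a -> forall (c : C) (x y : bl_car),
      bl_act a (c *: x + y) = c *: bl_act a x + bl_act a y;
  bl_act_linl : forall a b, l1 a -> l1 b -> forall (c : C) (x : bl_car),
      bl_act (c *: a + b) x = c *: bl_act a x + bl_act b x;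
  bl_act_assoc : forall a b, l1 a -> l1 b -> forall x : bl_car,
      bl_act (conv w a b) x = bl_act a (bl_act b x);
  bl_act_bound : forall a, l1 a -> forall x : bl_car,
      nrm (bl_act a x) <= l1norm a * nrm x
}.

Definition is_linear (V W : lmodType C) (f : V -> W) : Prop :=
  forall (c : C) x y, f (c *: x + y) = c *: f x + f y.

Definition bounded_map (V W : normedModType C) (f : V -> W) : Prop :=
  exists M : R, forall x, nrm (f x) <= M * nrm x.

Definition is_lmod_hom (w : G -> R) (F H : banach_lmod w) (f : F -> H) : Prop :=
  forall a, l1 a -> forall x : F, f (bl_act a x) = bl_act a (f x).

Definition closed_complemented (V : normedModType C) (S : set V) : Prop :=
  closed S /\
  exists W : set V,
    [/\ W 0, (forall (c : C) x y, W x -> W y -> W (c *: x + y)), closed W,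
        S `&` W `<=` [set 0]
      & forall y, exists u v, [/\ S u, W v & y = u + v]].

(** Left-injectivity of a normed left module E, given as a linear subspace
    [E] of a vector space [V], with norm [nE] and action [actE]. *)
Definition left_injective_mod (w : G -> R) (V : lmodType C) (E : set V)
    (nE : V -> R) (actE : (G -> C) -> V -> V) : Prop :=
  forall (F H : banach_lmod w) (theta : F -> H) (sigma : F -> V),
    is_linear theta -> bounded_map theta -> is_lmod_hom theta ->
    injective theta -> closed_complemented (range theta) ->
    is_linear sigma -> (forall x, E (sigma x)) ->
    (exists M : R, forall x, nE (sigma x) <= M * nrm x) ->
    (forall a, l1 a -> forall x, sigma (bl_act a x) = actE a (sigma x)) ->
    exists rho : H -> V,
      [/\ is_linear rho, (forall y, E (rho y)),
          (exists M : R, forall y, nE (rho y) <= M * nrm y),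
          (forall a, l1 a -> forall y, rho (bl_act a y) = actE a (rho y))
        & forall x, rho (theta x) = sigma x].

Definition c0 : set (G -> C) :=
  [set f | forall eps : R, 0 < eps -> finite_set [set g | eps <= cabs (f g)]].

Definition supnorm (f : G -> C) : R := sup [set cabs (f g) | g in [set: G]].

(** Dual module action on l^infty(G) = A' (pairing <mu, b> = sum_s mu(s) b(s)):
    <a . mu, b> = mu(b * a), so (a . mu)(t) = <mu, delta_t * a>. *)
Definition dual_act (w : G -> R) (a : G -> C) (mu : G -> C) : G -> C :=
  fun t => csum (fun s => mu s * conv w (delta t) a s).

End WeightedL1.

(* Main.v *)
(** Let H = B(A, c_0(G)), identified with bounded functions phi(t, g) on G x G
that vanish at infinity in t for each g. The module map
x |-> ((t, g) |-> Omega(t, g) x(tg)) embeds c_0(G) in H with complemented range,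
so left-injectivity gives a module retraction rho : H -> c_0(G).

Fix an injection N : G -> nat. For bounded f, the function
Omega(t, g) f(tg) lies in H after it is set to zero where
N(g) <= min(N(t), N(tg)). Applying rho turns this lift into a bounded linear map
from l^oo(G) to c_0(G), so by Phillips' lemma its diagonal entries at r tend to 0.

On the other hand the lift of delta_r differs from the image of delta_r by the
restriction of Omega(t, g) to { tg = r, t in U_r }, where each U_r is finite and
each t lies in only finitely many U_r. By equivariance the value at r of rho on
this restriction equals m(U_r), for one bounded finitely additive m not
depending on r. Hence m(U_r) > 1/2 for almost all r; disjoint U_r's then make m
unbounded. *)

Require Import Defs.
From HB Require Import structures.
From mathcomp Require Import all_boot all_order all_algebra.
From mathcomp Require Import all_classical all_reals all_analysis.
From mathcomp Require Import complex.
From mathcomp Require Import ring lra.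

Set Implicit Arguments.
Unset Strict Implicit.
Unset Printing Implicit Defensive.

Import Order.TTheory GRing.Theory Num.Theory.
Import numFieldNormedType.Exports.

Local Open Scope classical_set_scope.
Local Open Scope ring_scope.

(** * Sums over a group *)

Section ComplexModulus.
Variable R : realType.
Local Notation C := R[i].
Implicit Types (z u : C) (x : R).

Lemma cabsE z : cabs z = Num.sqrt (complex.Re z ^+ 2 + complex.Im z ^+ 2).
Proof. by rewrite /cabs normc_def. Qed.

Lemma cabsC z : RtoC (cabs z) = `|z|.
Proof. by rewrite cabsE normc_def. Qed.

Lemma RtoC_inj : injective (@RtoC R).
Proof. by move=> x y []. Qed.

Lemma RtoCD : {morph @RtoC R : x y / x + y}.
Proof. exact: (rmorphD (real_complex R)). Qed.

Lemma RtoCM : {morph @RtoC R : x y / x * y}.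
Proof. exact: (rmorphM (real_complex R)). Qed.

Lemma RtoC_le x y : (RtoC x <= RtoC y) = (x <= y).
Proof. by rewrite lecE /= eqxx. Qed.

Lemma RtoC_lt x y : (RtoC x < RtoC y) = (x < y).
Proof. by rewrite ltcE /= eqxx. Qed.

Lemma cabs_ge0 z : 0 <= cabs z.
Proof. by rewrite cabsE sqrtr_ge0. Qed.

Lemma cabsM z u : cabs (z * u) = cabs z * cabs u.
Proof. by apply: RtoC_inj; rewrite RtoCM !cabsC normrM. Qed.

Lemma cabsD z u : cabs (z + u) <= cabs z + cabs u.
Proof. by rewrite -RtoC_le RtoCD !cabsC ler_normD. Qed.

Lemma cabsN z : cabs (- z) = cabs z.
Proof. by apply: RtoC_inj; rewrite !cabsC normrN. Qed.

Lemma cabs0 : cabs 0 = 0 :> R.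
Proof. by apply: RtoC_inj; rewrite cabsC normr0. Qed.

Lemma cabs1 : cabs 1 = 1 :> R.
Proof. by apply: RtoC_inj; rewrite cabsC normr1. Qed.

Lemma cabs_eq0 z : cabs z = 0 -> z = 0.
Proof. by move=> /(congr1 (@RtoC R)); rewrite cabsC => /normr0_eq0. Qed.

Lemma cabs_RtoC x : cabs (RtoC x) = `|x|.
Proof. by rewrite cabsE /= expr0n /= addr0 sqrtr_sqr. Qed.

Lemma ReIm_eq z u : complex.Re z = complex.Re u ->
  complex.Im z = complex.Im u -> z = u.
Proof. by case: z u => [? ?] [? ?] /= -> ->. Qed.

Lemma ReD z u : complex.Re (z + u) = complex.Re z + complex.Re u.
Proof. by case: z u => [? ?] [? ?]. Qed.

Lemma ReN z : complex.Re (- z) = - complex.Re z.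
Proof. by case: z. Qed.

Lemma normRe_le_cabs z : `|complex.Re z| <= cabs z.
Proof.
by rewrite cabsE -sqrtr_sqr ler_wsqrtr// lerDl sqr_ge0.
Qed.

Lemma normIm_le_cabs z : `|complex.Im z| <= cabs z.
Proof.
by rewrite cabsE -[leLHS]sqrtr_sqr ler_wsqrtr// lerDr sqr_ge0.
Qed.

Lemma cabs_le_ReIm z : cabs z <= `|complex.Re z| + `|complex.Im z|.
Proof.
rewrite cabsE -[leRHS]ger0_norm ?addr_ge0// -sqrtr_sqr ler_wsqrtr//.
rewrite sqrrD !real_normK ?num_real//.
have : 0 <= `|complex.Re z| * `|complex.Im z| by rewrite mulr_ge0.
by lra.
Qed.

Lemma exists_phase z : exists2 u, cabs u <= 1 & u * z = RtoC (cabs z).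
Proof.
have [->|z0] := eqVneq z 0.
  by exists 0; rewrite ?mulr0 cabs0.
exists (`|z| / z); last by rewrite mulfVK// cabsC.
have -> : cabs (`|z| / z) = 1; last exact: lexx.
by apply: RtoC_inj; rewrite cabsC normrM normfV normr_id divff// normr_eq0.
Qed.

End ComplexModulus.

(** * Unconditional sums over the group: scaling, Fubini, reindexing, tails *)

Section Sums.
Variables (R : realType) (G : groupType).
Local Notation C := R[i].
Implicit Types (f p q : G -> R) (a b : G -> C).

Definition nnsum f : \bar R := (\esum_(g in [set: G]) (f g)%:E)%E.

Definition rsummable f := (nnsum (fun g => `|f g|)%R < +oo)%E.

Lemma nnsum_ge0 p : (forall g, 0 <= p g) -> (0 <= nnsum p)%E.
Proof. by move=> p0; apply: esum_ge0 => g _; rewrite lee_fin. Qed.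

Lemma nnsum_fin p : (forall g, 0 <= p g) -> (nnsum p < +oo)%E ->
  nnsum p \is a fin_num.
Proof. by move=> p0 poo; rewrite ge0_fin_numE// nnsum_ge0. Qed.

Lemma nnsumD p q : (forall g, 0 <= p g) -> (forall g, 0 <= q g) ->
  nnsum (fun g => p g + q g)%R = (nnsum p + nnsum q)%E.
Proof.
by move=> p0 q0; rewrite -esumD => [|g _|g _]; rewrite ?lee_fin.
Qed.

Lemma le_nnsum p q : (forall g, p g <= q g) -> (nnsum p <= nnsum q)%E.
Proof. by move=> pq; apply: le_esum => g _; rewrite lee_fin. Qed.

Lemma nnsum_lty p q : (forall g, p g <= q g) -> (nnsum q < +oo)%E ->
  (nnsum p < +oo)%E.
Proof. by move=> /le_nnsum; exact: le_lt_trans. Qed.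

(** The factor [k] is dominated by a natural number [n], and a multiple by [n] is an [n]-fold sum,
    so additivity suffices. *)
Lemma nnsumZ_lty (k : R) p : 0 <= k -> (forall g, 0 <= p g) ->
  (nnsum p < +oo)%E -> (nnsum (fun g => k * p g)%R < +oo)%E.
Proof.
move=> k0 p0 poo; have [n kn] : exists n : nat, k <= n%:R.
  by exists (Num.truncn k).+1; exact/ltW/truncnS_gt.
apply: (@nnsum_lty _ (fun g => n%:R * p g)).
  by move=> g; rewrite ler_wpM2r.
elim: n {k k0 kn} => [|n IHn].
  by rewrite /nnsum esum1// => g _; rewrite mul0r.
rewrite (_ : (fun _ => _) = (fun g => p g + n%:R * p g)); last first.
  by apply/funext => g; rewrite -natr1 mulrDl mul1r addrC.
by rewrite nnsumD// => [|g]; rewrite ?lte_add_pinfty ?mulr_ge0.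
Qed.

(* The defining positive/negative parts may be replaced by any nonnegative
   decomposition with finite sums; additivity and Fubini follow from this. *)
Lemma rsum_diff f p q : (forall g, 0 <= p g) -> (forall g, 0 <= q g) ->
  (nnsum p < +oo)%E -> (nnsum q < +oo)%E -> (forall g, f g = p g - q g) ->
  rsum f = fine (nnsum p) - fine (nnsum q).
Proof.
move=> p0 q0 poo qoo fpq.
pose fp g := Num.max (f g) 0; pose fm g := Num.max (- f g) 0.
have fp0 g : 0 <= fp g by rewrite le_max lexx orbT.
have fm0 g : 0 <= fm g by rewrite le_max lexx orbT.
have fpoo : (nnsum fp < +oo)%E.
  apply: nnsum_lty poo => g; rewrite /fp ge_max p0 andbT fpq.
  by have := q0 g; lra.
have fmoo : (nnsum fm < +oo)%E.
  apply: nnsum_lty qoo => g; rewrite /fm ge_max q0 andbT fpq.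
  by have := p0 g; lra.
have : (nnsum fp + nnsum q = nnsum fm + nnsum p)%E.
  rewrite -!nnsumD//; congr nnsum; apply/funext => g.
  have := fpq g; rewrite /fp /fm.
  by case: leP => h1; case: leP => h2; lra.
move=> /(congr1 fine); rewrite !fineD ?nnsum_fin//.
by rewrite /rsum -/(nnsum fp) -/(nnsum fm); lra.
Qed.

Lemma rsummable_parts f : rsummable f ->
  exists p q, [/\ forall g, 0 <= p g, forall g, 0 <= q g,
    (nnsum p < +oo)%E, (nnsum q < +oo)%E & forall g, f g = p g - q g].
Proof.
move=> foo; exists (fun g => Num.max (f g) 0), (fun g => Num.max (- f g) 0).
split=> [g|g|||g]; rewrite ?le_max ?lexx ?orbT//.
- by apply: nnsum_lty foo => g; rewrite ge_max normr_ge0 ler_norm.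
- by apply: nnsum_lty foo => g; rewrite ge_max normr_ge0 -normrN ler_norm.
- by case: leP => h1; case: leP => h2; lra.
Qed.

Lemma rsumD f1 f2 : rsummable f1 -> rsummable f2 ->
  rsum (fun g => f1 g + f2 g) = rsum f1 + rsum f2.
Proof.
move=> /rsummable_parts[p1 [q1 [p10 q10 p1oo q1oo e1]]].
move=> /rsummable_parts[p2 [q2 [p20 q20 p2oo q2oo e2]]].
rewrite (rsum_diff p10 q10 p1oo q1oo e1) (rsum_diff p20 q20 p2oo q2oo e2).
rewrite (@rsum_diff _ (fun g => p1 g + p2 g) (fun g => q1 g + q2 g)).
- by rewrite !nnsumD// !fineD ?nnsum_fin//; lra.
- by move=> g; rewrite addr_ge0.
- by move=> g; rewrite addr_ge0.
- by rewrite nnsumD// lte_add_pinfty.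
- by rewrite nnsumD// lte_add_pinfty.
- by move=> g; rewrite e1 e2; lra.
Qed.

Lemma rsumN f : rsummable f -> rsum (fun g => - f g) = - rsum f.
Proof.
move=> /rsummable_parts[p [q [p0 q0 poo qoo e]]].
rewrite (rsum_diff p0 q0 poo qoo e) (rsum_diff q0 p0 qoo poo) ?opprB// => g.
by rewrite e opprB.
Qed.

(** The bound [<=] is checked on finite partial sums. Applied to the factor [k^-1] and the function
    [k * p], the same bound gives the reverse inequality. *)
Lemma fine_nnsumZ (k : R) p : 0 <= k -> (forall g, 0 <= p g) ->
  (nnsum p < +oo)%E -> fine (nnsum (fun g => k * p g)%R) = k * fine (nnsum p).
Proof.
have le1 (c : R) p1 : 0 <= c -> (forall g, 0 <= p1 g) -> (nnsum p1 < +oo)%E ->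
    fine (nnsum (fun g => c * p1 g)%R) <= c * fine (nnsum p1).
  move=> c0 p10 p1oo; rewrite -lee_fin fineK; last first.
    by apply: nnsum_fin (nnsumZ_lty _ _ _) => // g; rewrite mulr_ge0.
  apply: ge_ereal_sup => _ [A [finA _] <-].
  rewrite fsumEFin// -mulr_fsumr.
  rewrite lee_fin ler_wpM2l// -lee_fin fineK ?nnsum_fin// -fsumEFin//.
  by apply: esum_ge; exists A.
move=> k0 p0 poo; apply/eqP; rewrite eq_le le1//=.
have [->|kn0] := eqVneq k 0.
  by rewrite mul0r fine_ge0// nnsum_ge0// => g; rewrite mul0r.
have kgt0 : 0 < k by rewrite lt_neqAle eq_sym kn0.
have := le1 k^-1 (fun g => k * p g).
have kK : (fun g => k^-1 * (k * p g)) = p by apply/funext => g; rewrite mulKf.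
rewrite invr_ge0 kK => h.
rewrite mulrC -ler_pdivlMr// mulrC h// => [g|]; first by rewrite mulr_ge0.
exact: nnsumZ_lty.
Qed.

Lemma rsumZ k f : rsummable f -> rsum (fun g => k * f g) = k * rsum f.
Proof.
wlog k0 : k / 0 <= k => [hwlog foo|].
  have [k0|k0] := leP 0 k; first exact: hwlog.
  have kf : rsummable (fun g => - k * f g).
    rewrite /rsummable (_ : (fun _ => _) = (fun g => - k * `|f g|)).
      by apply: nnsumZ_lty => //; lra.
    by apply/funext => g; rewrite normrM ger0_norm//; lra.
  rewrite -[RHS]opprK -mulNr -hwlog//; last by lra.
  by rewrite -rsumN//; congr rsum; apply/funext => g; lra.
move=> /rsummable_parts[p [q [p0 q0 poo qoo e]]].
rewrite (rsum_diff p0 q0 poo qoo e).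
rewrite (@rsum_diff _ (fun g => k * p g) (fun g => k * q g)).
- by rewrite !fine_nnsumZ// mulrBr.
- by move=> g; rewrite mulr_ge0.
- by move=> g; rewrite mulr_ge0.
- exact: nnsumZ_lty.
- exact: nnsumZ_lty.
- by move=> g; rewrite e mulrBr.
Qed.

Lemma nnsum_fubini (F : G -> G -> R) : (forall g h, 0 <= F g h) ->
  (\esum_(g in [set: G]) nnsum (F g) =
   \esum_(h in [set: G]) nnsum (F^~ h))%E.
Proof.
move=> F0; rewrite /nnsum !esum_esum => [|g h _ _|g h _ _]; rewrite ?lee_fin//.
apply: (@reindex_esum _ _ _ _ _ (fun k : G * G => (k.2, k.1))).
split=> //.
- by move=> [g h] [g' h'] _ _ [-> ->].
- by move=> [g h] _; exists (h, g).
Qed.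

(** By [key], each iterated sum is a difference of two double sums of nonnegative terms, coming from
    the positive and negative parts of [F]; for these the order of summation is free. *)
Lemma rsum_fubini (F : G -> G -> R) :
  (\esum_(g in [set: G]) nnsum (fun h => `|F g h|)%R < +oo)%E ->
  rsum (fun g => rsum (F g)) = rsum (fun h => rsum (F^~ h)).
Proof.
move=> Foo.
pose P g h := Num.max (F g h) 0; pose Q g h := Num.max (- F g h) 0.
have P0 g h : 0 <= P g h by rewrite le_max lexx orbT.
have Q0 g h : 0 <= Q g h by rewrite le_max lexx orbT.
have PF g h : P g h <= `|F g h| by rewrite ge_max normr_ge0 ler_norm.
have QF g h : Q g h <= `|F g h| by rewrite ge_max normr_ge0 -normrN ler_norm.
have FPQ g h : F g h = P g h - Q g h.
  by rewrite /P /Q; case: leP => h1; case: leP => h2; lra.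
(* Finiteness of the double sum bounds every inner sum, so [fine] never replaces an infinite inner
   sum by its default value 0. *)
have aux (T : G -> G -> R) : (forall g h, 0 <= T g h) ->
    (\esum_(g in [set: G]) nnsum (T g) < +oo)%E ->
    [/\ forall g, (nnsum (T g) < +oo)%E,
        (nnsum (fun g => fine (nnsum (T g)))%R < +oo)%E
      & fine (nnsum (fun g => fine (nnsum (T g)))%R) =
        fine (\esum_(g in [set: G]) nnsum (T g))].
  move=> T0 Too.
  have h1 g : (nnsum (T g) < +oo)%E.
    apply: le_lt_trans Too; apply: esum_ge; exists [set g].
      by split=> //; exact: finite_set1.
    by rewrite fsbig_set1.
  have h2 : nnsum (fun g => fine (nnsum (T g)))%R =
      (\esum_(g in [set: G]) nnsum (T g))%E.
    by apply: eq_esum => g _; rewrite fineK// nnsum_fin.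
  by split=> //; rewrite h2.
have key (T P1 Q1 : G -> G -> R) : (forall g h, T g h = P1 g h - Q1 g h) ->
    (forall g h, 0 <= P1 g h) -> (forall g h, 0 <= Q1 g h) ->
    (\esum_(g in [set: G]) nnsum (P1 g) < +oo)%E ->
    (\esum_(g in [set: G]) nnsum (Q1 g) < +oo)%E ->
    rsum (fun g => rsum (T g)) =
      fine (\esum_(g in [set: G]) nnsum (P1 g)) -
      fine (\esum_(g in [set: G]) nnsum (Q1 g)).
  move=> TPQ P10 Q10 /aux-/(_ P10)[h1 h2 <-] /aux-/(_ Q10)[h3 h4 <-].
  apply: rsum_diff => // [g|g|g].
  - by rewrite fine_ge0// nnsum_ge0.
  - by rewrite fine_ge0// nnsum_ge0.
  - exact: rsum_diff.
have le_dbl (T : G -> G -> R) : (forall g h, T g h <= `|F g h|) ->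
    (\esum_(g in [set: G]) nnsum (T g) < +oo)%E.
  move=> TF; apply: le_lt_trans Foo.
  by apply: le_esum => g _; exact: le_nnsum.
rewrite (key _ P Q)//; [|exact: le_dbl|exact: le_dbl].
rewrite (key _ (fun h g => P g h) (fun h g => Q g h))//.
- by rewrite (nnsum_fubini P0) (nnsum_fubini Q0).
- by rewrite -(nnsum_fubini P0) le_dbl.
- by rewrite -(nnsum_fubini Q0) le_dbl.
Qed.

Lemma nnsum_reindex (e e' : G -> G) p : cancel e e' -> cancel e' e ->
  nnsum (fun g => p (e g))%R = nnsum p.
Proof.
move=> ee' e'e; apply/esym/reindex_esum; split=> //.
- by move=> g h _ _; exact: can_inj ee' _ _.
- by move=> g _; exists (e' g).
Qed.

Lemma l1E a : l1 a = (nnsum (fun g => cabs (a g))%R < +oo)%E.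
Proof. by []. Qed.

Lemma l1normE a : l1norm a = fine (nnsum (fun g => cabs (a g))%R).
Proof. by []. Qed.

Lemma l1_Re a : l1 a -> rsummable (fun g => complex.Re (a g)).
Proof. by apply: nnsum_lty => g; exact: normRe_le_cabs. Qed.

Lemma l1_Im a : l1 a -> rsummable (fun g => complex.Im (a g)).
Proof. by apply: nnsum_lty => g; exact: normIm_le_cabs. Qed.

Lemma l1_dom (k : R) a b : 0 <= k ->
  (forall g, cabs (b g) <= k * cabs (a g)) -> l1 a -> l1 b.
Proof.
move=> k0 ba al1; apply: (nnsum_lty ba).
by apply: nnsumZ_lty => // g; exact: cabs_ge0.
Qed.

Lemma l1Z (k : C) a : l1 a -> l1 (fun g => k * a g).
Proof. by apply: (l1_dom (cabs_ge0 k)) => g; rewrite cabsM. Qed.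

Lemma l1D a b : l1 a -> l1 b -> l1 (fun g => a g + b g).
Proof.
move=> al1 bl1; apply: (@nnsum_lty _ (fun g => cabs (a g) + cabs (b g))).
  by move=> g; exact: cabsD.
by rewrite nnsumD ?lte_add_pinfty// => g; exact: cabs_ge0.
Qed.

Lemma l1_bounded_mul (k : R) a b : l1 a -> (forall g, cabs (b g) <= k) ->
  l1 (fun g => a g * b g).
Proof.
move=> al1 bk; apply: (@l1_dom k a) => // [|g].
  exact: le_trans (cabs_ge0 _) (bk 1%g).
by rewrite cabsM mulrC ler_wpM2r ?cabs_ge0.
Qed.

Lemma l1norm_ge0 a : 0 <= l1norm a.
Proof. by rewrite l1normE fine_ge0// nnsum_ge0// => g; exact: cabs_ge0. Qed.

Lemma l1norm_bounded_mul (k : R) a b : l1 a -> (forall g, cabs (b g) <= k) ->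
  l1norm (fun g => a g * b g) <= l1norm a * k.
Proof.
move=> al1 bk; have k0 := le_trans (cabs_ge0 _) (bk 1%g).
have a0 g := cabs_ge0 (a g).
rewrite mulrC !l1normE -fine_nnsumZ// fine_le ?nnsum_fin//.
- by move=> g; exact: cabs_ge0.
- exact: l1_bounded_mul bk.
- by move=> g; rewrite mulr_ge0.
- exact: nnsumZ_lty.
- by apply: le_nnsum => g; rewrite cabsM mulrC ler_wpM2r.
Qed.

Lemma csumD a b : l1 a -> l1 b ->
  csum (fun g => a g + b g) = csum a + csum b.
Proof.
move=> al1 bl1; rewrite /csum.
apply: ReIm_eq => /=.
- rewrite -rsumD; [|exact: l1_Re..].
  by congr rsum; apply/funext => g; rewrite ReD.
- rewrite -rsumD; [|exact: l1_Im..].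
  by congr rsum; apply/funext => g; case: (a g) (b g) => [? ?] [? ?].
Qed.

Lemma rsummableZ (k : R) f : rsummable f -> rsummable (fun g => k * f g).
Proof.
move=> foo; rewrite /rsummable.
rewrite (_ : (fun _ => _) = (fun g => `|k| * `|f g|)); last first.
  by apply/funext => g; rewrite normrM.
by apply: nnsumZ_lty.
Qed.

Lemma csumZ (k : C) a : l1 a -> csum (fun g => k * a g) = k * csum a.
Proof.
move=> al1; case: k => x y; rewrite /csum.
have ReZ c := rsummableZ c (l1_Re al1); have ImZ c := rsummableZ c (l1_Im al1).
apply: ReIm_eq => /=.
- rewrite -mulNr -!rsumZ; [|exact: l1_Im|exact: l1_Re].
  rewrite -rsumD//; congr rsum; apply/funext => g.
  by case: (a g) => u v /=; rewrite mulNr.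
- rewrite -!rsumZ; [|exact: l1_Re|exact: l1_Im].
  rewrite -rsumD//; congr rsum; apply/funext => g.
  by case: (a g) => u v /=.
Qed.

Lemma rsum_le f p : rsummable f -> (forall g, 0 <= p g) ->
  (nnsum p < +oo)%E -> (forall g, f g <= p g) -> rsum f <= fine (nnsum p).
Proof.
move=> foo p0 poo fp; rewrite /rsum lerBlDr.
apply: le_trans (_ : fine (nnsum p) <= _); last first.
  rewrite lerDl fine_ge0//; apply: esum_ge0 => g _.
  by rewrite lee_fin le_max lexx orbT.
apply: fine_le; rewrite ?nnsum_fin//.
- by move=> g; rewrite le_max lexx orbT.
- by apply: nnsum_lty poo => g; rewrite ge_max fp p0.
- by apply: (@le_nnsum (fun g => Num.max (f g) 0)) => g; rewrite ge_max fp p0.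
Qed.

Lemma cabs_csum a : l1 a -> cabs (csum a) <= l1norm a.
Proof.
(* Multiplying by a phase [u] turns the sum into its own modulus, so it is enough to bound the real
   part of [u * a g] termwise. *)
move=> al1; have [u u1 uE] := exists_phase (csum a).
have -> : cabs (csum a) = complex.Re (csum (fun g => u * a g)).
  by rewrite csumZ// uE.
apply: rsum_le => //.
- exact/l1_Re/l1Z.
- by move=> g; exact: cabs_ge0.
- move=> g; apply: le_trans (ler_norm _) _.
  apply: le_trans (normRe_le_cabs _) _.
  by rewrite cabsM ler_piMl ?cabs_ge0.
Qed.

Lemma csum_fubini (F : G -> G -> C) :
  (\esum_(g in [set: G]) nnsum (fun h => cabs (F g h))%R < +oo)%E ->
  csum (fun g => csum (F g)) = csum (fun h => csum (F^~ h)).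
Proof.
move=> Foo; rewrite /csum; congr Complex; apply: rsum_fubini.
- apply: le_lt_trans Foo; apply: le_esum => g _; apply: le_nnsum => h.
  exact: normRe_le_cabs.
- apply: le_lt_trans Foo; apply: le_esum => g _; apply: le_nnsum => h.
  exact: normIm_le_cabs.
Qed.

Lemma csum_reindex (e e' : G -> G) a : cancel e e' -> cancel e' e ->
  csum (fun g => a (e g)) = csum a.
Proof.
move=> ee' e'e; have E p := @nnsum_reindex e e' p ee' e'e.
have Er f : rsum (fun g => f (e g)) = rsum f.
  by congr (fine _ - fine _); [exact: (E (fun g => Num.max (f g) 0))|
                               exact: (E (fun g => Num.max (- f g) 0))].
by rewrite /csum (Er (fun g => complex.Re (a g))) (Er (fun g => complex.Im (a g))).
Qed.

(** The total is a supremum of finite partial sums; [A] is the support of a partial sum that comes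
    within [eps] of it. *)
Lemma nnsum_tail p (eps : R) : (forall g, 0 <= p g) -> (nnsum p < +oo)%E ->
  0 < eps -> exists2 A : set G, finite_set A &
    (nnsum (fun g => if g \in A then 0 else p g)%R <= eps%:E)%E.
Proof.
move=> p0 poo eps0.
have [_ [A [finA _] <-] hA] : exists2 x, [set (\sum_(g \in A) (p g)%:E)%E
    | A in fsets [set: G]] x & (nnsum p - eps%:E < x)%E.
  by apply: ub_ereal_sup_adherent; rewrite ?nnsum_fin.
exists A => //.
have : nnsum p = (nnsum (fun g => if g \in A then p g else 0)%R +
   nnsum (fun g => if g \in A then 0 else p g)%R)%E.
  rewrite -nnsumD.
  - by congr nnsum; apply/funext => g; case: ifP; rewrite ?addr0 ?add0r.
  - by move=> g; case: ifP.
  - by move=> g; case: ifP.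
have -> : nnsum (fun g => if g \in A then p g else 0)%R =
    (\sum_(g \in A) (p g)%:E)%E.
  rewrite -esum_fset => [||g _]; rewrite ?lee_fin//.
  rewrite [RHS]esum_mkcond; apply: eq_esum => g _.
  by case: ifP.
move=> e; move: hA poo; rewrite e fsumEFin//.
set s := \sum_(_ \in _) _; set t := nnsum _.
have : (0 <= t)%E by apply: nnsum_ge0 => g; case: ifP.
case: t => [t| |]//= _; rewrite -!EFinD lte_fin lee_fin => + _.
by lra.
Qed.

End Sums.

(** * Functions vanishing at infinity along a family of sets *)

Section VanishingFunctions.
Variables (R : realType) (X : Type) (D : set (set X)).
Local Notation C := R[i].

(** The family [D] lists the sets along which decay is required, so that one construction serves two
    spaces: the whole space gives [c_0(G)], and the slices with fixed second coordinate give the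
    operators from [A] to [c_0(G)]. *)
Definition vanishing (f : X -> C) : Prop :=
  (exists K : R, forall x, cabs (f x) <= K) /\
  forall S, D S -> forall eps : R, 0 < eps ->
    finite_set [set x | S x /\ eps <= cabs (f x)].

Definition vanishing_pred : {pred (X -> C)} := fun f => `[< vanishing f >].

Lemma vanishing_submod_closed : submod_closed vanishing_pred.
Proof.
split=> [|c f g /asboolP[[K fK] f0] /asboolP[[L gL] g0]].
  apply/asboolP; split; first by exists 0 => x; rewrite cabs0.
  move=> S _ eps eps0; rewrite (_ : mkset _ = set0)//.
  by rewrite -subset0 => x [_]; rewrite cabs0 leNgt eps0.
apply/asboolP; split.
  exists (cabs c * K + L) => x; apply: le_trans (cabsD _ _) _.
  by rewrite lerD// cabsM ler_wpM2l ?cabs_ge0.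
move=> S DS eps eps0; have c0 := cabs_ge0 c.
have d0 : 0 < eps / (2 * (cabs c + 1)) by rewrite divr_gt0//; lra.
have e0 : 0 < eps / 2 by lra.
apply: (@sub_finite_set _ _ ([set x | S x /\ eps / (2 * (cabs c + 1)) <= cabs (f x)]
  `|` [set x | S x /\ eps / 2 <= cabs (g x)])); last first.
  by rewrite finite_setU; split; [exact: f0|exact: g0].
move=> x [Sx h] /=.
have [h1|h1] := leP (eps / (2 * (cabs c + 1))) (cabs (f x)); first by left.
right; split=> //; rewrite leNgt; apply/negP => h2.
have : cabs (c * f x + g x) < eps; last by rewrite ltNge h.
apply: le_lt_trans (cabsD _ _) _; rewrite cabsM.
have : cabs c * cabs (f x) <= (cabs c + 1) * (eps / (2 * (cabs c + 1))).
  by rewrite ler_pM ?cabs_ge0 ?ltW//; lra.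
rewrite (_ : (cabs c + 1) * _ = eps / 2); first by lra.
by field; lra.
Qed.

HB.instance Definition _ := GRing.isSubmodClosed.Build C (X -> C) vanishing_pred
  vanishing_submod_closed.

Record vfun := VFun { vfun_val :> X -> C; _ : vfun_val \in vanishing_pred }.

HB.instance Definition _ := [isSub for vfun_val].
HB.instance Definition _ := [Choice of vfun by <:].
HB.instance Definition _ := [SubChoice_isSubLmodule of vfun by <:].

Implicit Types f g : vfun.

Lemma vfunP f : vanishing f.
Proof. by apply/asboolP; case: f. Qed.

Lemma vfun_eq f g : (forall x, f x = g x) -> f = g.
Proof. by move=> fg; apply: val_inj; apply/funext. Qed.

Lemma vfunDE f g x : (f + g) x = f x + g x.
Proof. by []. Qed.

Lemma vfunBE f g x : (f - g) x = f x - g x.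
Proof. by []. Qed.

Lemma vfunZE (c : C) f x : (c *: f) x = c * f x.
Proof. by []. Qed.

Definition vnorm f : R := sup [set cabs (f x) | x in [set: X]].

Lemma cabs_le_vnorm f x : cabs (f x) <= vnorm f.
Proof.
apply: ub_le_sup; last by exists x.
by have [[K fK] _] := vfunP f; exists K => _ [y _ <-].
Qed.

Lemma vnorm_le f (K : R) : 0 <= K -> (forall x, cabs (f x) <= K) -> vnorm f <= K.
Proof.
move=> K0 fK; have [[x _]|X0] := pselect (exists x : X, True).
  by apply: ge_sup => [|_ [y _ <-]//]; exists (cabs (f x)), x.
rewrite /vnorm (_ : image _ _ = set0) ?sup0// -subset0 => _ [y _ <-].
by apply: X0; exists y.
Qed.

Lemma vnorm_ge0 f : 0 <= vnorm f.
Proof.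
have [[x _]|X0] := pselect (exists x : X, True).
  exact: le_trans (cabs_ge0 _) (cabs_le_vnorm f x).
rewrite /vnorm (_ : image _ _ = set0) ?sup0// -subset0 => _ [y _ <-].
by apply: X0; exists y.
Qed.

Lemma vnormD f g : RtoC (vnorm (f + g)) <= RtoC (vnorm f) + RtoC (vnorm g).
Proof.
rewrite -RtoCD RtoC_le vnorm_le ?addr_ge0 ?vnorm_ge0// => x.
by apply: le_trans (cabsD _ _) _; rewrite lerD ?cabs_le_vnorm.
Qed.

Lemma vnormZ (c : C) f : RtoC (vnorm (c *: f)) = `|c| * RtoC (vnorm f).
Proof.
have le1 (d : C) g : vnorm (d *: g) <= cabs d * vnorm g.
  rewrite vnorm_le ?mulr_ge0 ?cabs_ge0 ?vnorm_ge0// => x.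
  by rewrite vfunZE cabsM ler_wpM2l ?cabs_ge0// cabs_le_vnorm.
rewrite -cabsC -RtoCM; congr RtoC; apply/eqP; rewrite eq_le le1/=.
have [->|c0] := eqVneq c 0; first by rewrite cabs0 mul0r vnorm_ge0.
have cgt0 : 0 < cabs c.
  rewrite lt_neqAle cabs_ge0 andbT eq_sym; apply: contra_neq c0.
  exact: cabs_eq0.
have := le1 c^-1 (c *: f); rewrite scalerA mulVf// scale1r.
have -> : cabs c^-1 = (cabs c)^-1.
  by apply: (mulIf (lt0r_neq0 cgt0)); rewrite mulVf ?gt_eqF// -cabsM mulVf// cabs1.
by rewrite mulrC ler_pdivlMr// mulrC.
Qed.

Lemma vnorm_eq0 f : RtoC (vnorm f) = 0 -> f = 0.
Proof.
move=> /RtoC_inj f0; apply: vfun_eq => x; apply: cabs_eq0; apply/eqP.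
by rewrite eq_le cabs_ge0 -f0 cabs_le_vnorm.
Qed.

HB.instance Definition _ := Lmodule_isNormed.Build C vfun
  vnormD vnormZ vnorm_eq0.

Lemma nrm_vfun f : nrm f = vnorm f.
Proof. by []. Qed.

Lemma ball_vfun f g (e : R) : ball f (RtoC e) g = (vnorm (f - g) < e) :> Prop.
Proof. by rewrite -ball_normE /= -[in RHS]RtoC_lt. Qed.

(** The limit [L] is taken pointwise, in the real and imaginary parts separately. The Cauchy
    condition makes the approximation uniform ([near_L]), and a uniform limit inherits boundedness
    and decay. *)
Lemma vfun_complete (F : set_system vfun) : ProperFilter F -> cauchy F -> cvg F.
Proof.
move=> FF /cauchyP Fc.
have {}Fc (e : R) : 0 < e -> exists f, F [set g | vnorm (f - g) < e].
  move=> e0; have [|f Ff] := Fc (RtoC e); first by rewrite RtoC_lt.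
  by exists f; apply: filterS Ff => g; rewrite ball_vfun.
have cv (u : C -> R) (x : X) : (forall z, `|u z| <= cabs z) ->
    {morph u : z w / z - w} -> cvg ((fun f => u (f x)) @ F).
  move=> u1 uB; apply: cauchy_cvg; apply: cauchy_exP => e e0.
  have [f Ff] := Fc e e0; exists (u (f x)).
  suff : F [set g | ball (u (f x)) e (u (g x))] by [].
  apply: filterS Ff => g /= fg; rewrite -ball_normE /= -uB; apply: le_lt_trans (u1 _) _.
  by apply: le_lt_trans fg; exact: (cabs_le_vnorm (f - g) x).
pose L x := Complex (lim ((fun f => complex.Re (f x)) @ F))
                    (lim ((fun f => complex.Im (f x)) @ F)).
(* The factor 2 arises because the real and the imaginary part are each within [e]. *)
have near_L (f : vfun) (e : R) x : F [set g | vnorm (f - g) < e] ->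
    cabs (f x - L x) <= 2 * e.
  move=> Ff.
  have lim_le (u : C -> R) : (forall z, `|u z| <= cabs z) ->
      {morph u : z w / z - w} -> `|u (f x) - lim ((fun g => u (g x)) @ F)| <= e.
    move=> u1 uB; have := cv u x u1 uB => /cvgrPdist_lt uF.
    apply/ler_addgt0Pr => d d0.
    have [g [/= fg gl]] := filter_ex (filterI Ff (uF d d0)).
    rewrite (_ : _ - _ = (u (f x) - u (g x)) + (u (g x) - lim ((fun g => u (g x)) @ F))).
      apply: le_trans (ler_normD _ _) _; apply: lerD; last by rewrite distrC ltW.
      rewrite -uB; apply: le_trans (u1 _) _; apply: le_trans (ltW fg).
      exact: (cabs_le_vnorm (f - g) x).
    by rewrite addrA subrK.
  apply: le_trans (cabs_le_ReIm _) _.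
  rewrite (_ : 2 * e = e + e); last by lra.
  apply: lerD.
    have := lim_le (@complex.Re R) (@normRe_le_cabs R); case: (f x) => a b.
    by apply=> -[? ?] [? ?].
  have := lim_le (@complex.Im R) (@normIm_le_cabs R); case: (f x) => a b.
  by apply=> -[? ?] [? ?].
have vL : L \in vanishing_pred.
  apply/asboolP; split.
    have [f Ff] := Fc 1 ltr01; exists (vnorm f + 2) => x.
    rewrite (_ : L x = f x - (f x - L x)); last by rewrite subKr.
    apply: le_trans (cabsD _ _) _; rewrite cabsN lerD ?cabs_le_vnorm//.
    by rewrite -[leRHS]mulr1; exact: near_L.
  move=> S DS e e0; have e40 : 0 < e / 4 by lra.
  have [f Ff] := Fc _ e40; have [_ /(_ S DS _ e40)] := vfunP f.
  apply: sub_finite_set => x [Sx eL]; split=> //.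
  have := near_L f _ x Ff; have := cabsD (f x) (- (f x - L x)).
  by rewrite subKr cabsN; lra.
apply/cvg_ex; exists (VFun vL); apply/fcvg_ballP => e e0.
(* Radii of balls are complex here; a positive one has zero imaginary part. *)
have [r [r0 ->]] : exists r : R, 0 < r /\ e = RtoC r.
  move: e0; case: e => a b; rewrite ltcE /= => /andP[/eqP -> a0].
  by exists a.
have r40 : 0 < r / 4 by lra.
have [f Ff] := Fc _ r40; apply: filterS (Ff) => g /= fg.
(* The distance from [L] to [g] is at most [r / 4] from [g] to [f] plus [2 * (r / 4)] from [f] to
   [L]. *)
rewrite ball_vfun; apply: (@le_lt_trans _ _ (3 / 4 * r)); last by lra.
apply: vnorm_le => [|x]; first by lra.
have := near_L f _ x Ff; have := cabs_le_vnorm (f - g) x.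
rewrite vfunBE => h1 h2.
suff : cabs (L x - g x) <= 3 / 4 * r by [].
have -> : L x - g x = (f x - g x) - (f x - L x).
  by rewrite opprB [RHS]addrC addrA subrK.
apply: le_trans (cabsD _ _) _; rewrite cabsN.
by lra.
Qed.

HB.instance Definition _ := Uniform_isComplete.Build vfun vfun_complete.

(** A function that is not vanishing is sent to the default 0; [to_vfunE] gives the values in the
    intended case. *)
Definition to_vfun (f : X -> C) : vfun := insubd (0 : vfun) f.

Lemma to_vfunE (f : X -> C) : vanishing f -> forall x, to_vfun f x = f x.
Proof.
by move=> fv x; rewrite /to_vfun -[vfun_val _]/(val _) insubdK//; exact/asboolP.
Qed.

End VanishingFunctions.

(** * Modules over the weighted algebra *)

Section Weights.
Variables (R : realType) (G : groupType) (w : G -> R).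
Hypothesis weight_w : is_weight w.
Local Notation Om g h := (Omega w g h).

Lemma weight_gt0 g : 0 < w g.
Proof. by case: weight_w. Qed.

Lemma Omega_gt0 g h : 0 < Om g h.
Proof. by rewrite divr_gt0 ?mulr_gt0 ?weight_gt0. Qed.

Lemma Omega_le1 g h : Om g h <= 1.
Proof.
rewrite ler_pdivrMr ?mulr_gt0 ?weight_gt0// mul1r.
by case: weight_w.
Qed.

(** Both sides equal [w (t * g * h) / (w t * w g * w h)]. This 2-cocycle identity underlies the
    associativity of the action, the equivariance of [embed] and the translation of slices. *)
Lemma Omega_cocycle t g h : Om g h * Om t (g * h)%g = Om t g * Om (t * g)%g h.
Proof.
rewrite /Omega mulgA.
have := weight_gt0 t; have := weight_gt0 g; have := weight_gt0 h.
have := weight_gt0 (g * h)%g; have := weight_gt0 (t * g)%g => *.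
by field; rewrite ?lt0r_neq0.
Qed.

Lemma Omega_1 g : Om g 1%g = 1.
Proof.
rewrite /Omega mulg1; case: weight_w => _ _ ->.
by rewrite mulr1 divff ?lt0r_neq0 ?weight_gt0.
Qed.

Lemma cabs_Omega_le1 g h : cabs (RtoC (Om g h)) <= 1.
Proof. by rewrite cabs_RtoC gtr0_norm ?Omega_gt0 ?Omega_le1. Qed.

(** * The module action on functions on [T * G], with translation in the second factor *)

Section Module.
Variables (T : Type) (D : set (set (T * G))).
Local Notation C := R[i].

Definition rtrans (h : G) (x : T * G) : T * G := (x.1, (x.2 * h)%g).

Lemma rtrans_inj h : injective (rtrans h).
Proof. by move=> [t g] [t' g'] [-> /mulIg ->]. Qed.

Hypothesis D_rtrans : forall S h, D S -> D (rtrans h @` S).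

Implicit Types (a b : G -> C) (f : vfun R D).

(** If [f (t, g)] stands for the value at [t] of an operator applied to [delta g], this is the
    action by precomposition with right multiplication by [a], since [delta g] times [a] is the sum
    over [h] of [a h * Omega w g h] times [delta (g * h)]. *)
Definition act_fun a (f : T * G -> C) (x : T * G) : C :=
  csum (fun h => a h * (RtoC (Om x.2 h) * f (rtrans h x))).

Lemma cabs_act_coef (f : T * G -> C) (K : R) x h : (forall y, cabs (f y) <= K) ->
  cabs (RtoC (Om x.2 h) * f (rtrans h x)) <= K.
Proof.
move=> fK; rewrite cabsM -[K]mul1r.
by rewrite ler_pM ?cabs_ge0// cabs_Omega_le1.
Qed.

Lemma act_fun_bound a (f : T * G -> C) (K : R) x : l1 a ->
  (forall y, cabs (f y) <= K) -> cabs (act_fun a f x) <= l1norm a * K.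
Proof.
move=> al1 fK.
have cK h := @cabs_act_coef f K x h fK.
by apply: le_trans (cabs_csum (l1_bounded_mul al1 cK)) (l1norm_bounded_mul al1 cK).
Qed.

Lemma l1_act a f x : l1 a -> l1 (fun h => a h * (RtoC (Om x.2 h) * f (rtrans h x))).
Proof.
move=> al1; apply: l1_bounded_mul al1 _ => h.
by apply: cabs_act_coef => y; exact: cabs_le_vnorm.
Qed.

(** The function [a] is split into a finite part on [A] and a tail of small norm. The tail
    contributes little because [f] is bounded; on [A] only finitely many translates of [f] occur,
    and each is small off a finite subset of [S]. *)
Lemma act_fun_vanishing a f : l1 a -> vanishing D (act_fun a f).
Proof.
move=> al1; have [_ fv] := vfunP f; pose K := vnorm f.
have fK x : cabs (f x) <= K by exact: cabs_le_vnorm.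
have K0 : 0 <= K by exact: vnorm_ge0.
split; first by exists (l1norm a * K) => x; exact: act_fun_bound.
move=> S DS eps eps0.
(* The tail will contribute at most [eps / 4] and the part over [A] at most [eps / 2]; the added 1s
   keep the denominators positive. *)
have d0 : 0 < eps / (4 * (K + 1)) by rewrite divr_gt0//; lra.
have a0 g : 0 <= cabs (a g) by exact: cabs_ge0.
have [A finA tailA] := nnsum_tail a0 al1 d0.
pose eta := eps / (2 * (l1norm a + 1)).
have n0 := l1norm_ge0 a.
have eta0 : 0 < eta by rewrite divr_gt0//; lra.
apply: (@sub_finite_set _ _ (\bigcup_(h in A)
    [set x | S x /\ eta <= cabs (f (rtrans h x))])); last first.
  apply: bigcup_finite => // h _.
  apply: (@sub_finite_set _ _ (rtrans h @^-1`
      [set y | (rtrans h @` S) y /\ eta <= cabs (f y)])).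
    by move=> x [Sx ex]; split=> //; exists x.
  apply: finite_preimage; first by move=> x y _ _; exact: rtrans_inj.
  by apply: fv => //; exact: D_rtrans.
move=> x [Sx /= ex]; apply: contrapT => nA.
have small h : h \in A -> cabs (f (rtrans h x)) <= eta.
  move=> /set_mem Ah; rewrite leNgt; apply/negP => /ltW fe.
  by apply: nA; exists h.
suff : cabs (act_fun a f x) < eps by rewrite ltNge ex.
pose c h := RtoC (Om x.2 h) * f (rtrans h x).
pose c1 h := if h \in A then c h else 0.
pose a2 h := if h \in A then 0 else a h.
have cK h : cabs (c h) <= K by exact: cabs_act_coef.
have c1e h : cabs (c1 h) <= eta.
  rewrite /c1; case: ifPn => [hA|_]; last by rewrite cabs0 ltW.
  rewrite cabsM -[eta]mul1r ler_pM ?cabs_ge0 ?cabs_Omega_le1//.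
  exact: small.
have a2E : (fun g => cabs (a2 g)) = (fun g => if g \in A then 0 else cabs (a g)).
  by apply/funext => g; rewrite /a2; case: ifP; rewrite ?cabs0.
have a2l1 : l1 a2.
  by rewrite l1E a2E (le_lt_trans tailA) ?ltry.
have a2n : l1norm a2 <= eps / (4 * (K + 1)).
  rewrite -lee_fin l1normE fineK ?a2E// nnsum_fin//.
    by move=> g; case: ifP => // _; exact: cabs_ge0.
  by rewrite (le_lt_trans tailA) ?ltry.
have -> : act_fun a f x = csum (fun h => a h * c1 h) + csum (fun h => a2 h * c h).
  rewrite -csumD; [|exact: l1_bounded_mul c1e|exact: l1_bounded_mul cK].
  congr csum; apply/funext => h; rewrite /c1 /a2 -/(c h).
  by case: ifP; rewrite ?mul0r ?mulr0 ?addr0 ?add0r.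
apply: le_lt_trans (cabsD _ _) _.
have h1 : cabs (csum (fun h => a h * c1 h)) <= l1norm a * eta.
  exact: le_trans (cabs_csum (l1_bounded_mul al1 c1e)) (l1norm_bounded_mul al1 c1e).
have h2 : cabs (csum (fun h => a2 h * c h)) <= eps / (4 * (K + 1)) * K.
  apply: le_trans (cabs_csum (l1_bounded_mul a2l1 cK)) _.
  by apply: le_trans (l1norm_bounded_mul a2l1 cK) _; rewrite ler_wpM2r.
have h3 : l1norm a * eta <= (l1norm a + 1) * eta by rewrite ler_wpM2r ?ltW//; lra.
have h4 : eps / (4 * (K + 1)) * K <= eps / (4 * (K + 1)) * (K + 1).
  by rewrite ler_wpM2l ?ltW//; lra.
have e1 : (l1norm a + 1) * eta = eps / 2 by rewrite /eta; field; lra.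
have e2 : eps / (4 * (K + 1)) * (K + 1) = eps / 4 by field; lra.
by move: h1 h2 h3 h4; rewrite e1 e2; lra.
Qed.

(** The action in [banach_lmod] takes every function [G -> C], so a value is needed outside [l1]; it
    is set to 0. *)
Definition act a f : vfun R D :=
  if pselect (l1 a) is left _ then to_vfun D (act_fun a f) else 0.

Lemma actE a f x : l1 a -> act a f x = act_fun a f x.
Proof.
move=> al1; rewrite /act; case: pselect => // _.
by rewrite to_vfunE//; exact: act_fun_vanishing.
Qed.

Lemma act_linr a : l1 a -> forall (c : C) f g,
  act a (c *: f + g) = c *: act a f + act a g.
Proof.
move=> al1 c f g; apply: vfun_eq => x.
rewrite vfunDE vfunZE !actE// /act_fun -csumZ; last exact: l1_act.
rewrite -csumD; [|by apply/l1Z/l1_act|exact: l1_act].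
congr csum; apply/funext => h; rewrite vfunDE vfunZE.
by ring.
Qed.

Lemma act_linl a b : l1 a -> l1 b -> forall (c : C) f,
  act (c *: a + b) f = c *: act a f + act b f.
Proof.
move=> al1 bl1 c f; apply: vfun_eq => x.
have cabl1 : l1 (c *: a + b) by apply: l1D => //; exact: l1Z.
rewrite vfunDE vfunZE !actE// /act_fun -csumZ; last exact: l1_act.
rewrite -csumD; [|by apply/l1Z/l1_act|exact: l1_act].
congr csum; apply/funext => h.
rewrite -[(c *: a + b) h]/(c * a h + b h).
by ring.
Qed.

Lemma l1_le_norm a g : l1 a -> cabs (a g) <= l1norm a.
Proof.
move=> al1; rewrite -lee_fin l1normE fineK; last first.
  by rewrite nnsum_fin// => h; exact: cabs_ge0.
apply: esum_ge; exists [set g]; last by rewrite fsbig_set1.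
by split=> //; exact: finite_set1.
Qed.

Lemma l1_conv_term a b k : l1 a -> l1 b ->
  l1 (fun g => RtoC (Om g (g^-1 * k)%g) * a g * b (g^-1 * k)%g).
Proof.
move=> al1 bl1; apply: (l1_dom (l1norm_ge0 b)) al1 => g.
rewrite !cabsM mulrC ler_pM ?mulr_ge0 ?cabs_ge0//; first exact: l1_le_norm.
by rewrite -[leRHS]mul1r ler_pM ?cabs_ge0// cabs_Omega_le1.
Qed.

Lemma nnsum_cmul (k : R) a : 0 <= k -> l1 a ->
  nnsum (fun g => k * cabs (a g)) = (k * l1norm a)%:E.
Proof.
move=> k0 al1; have a0 g := cabs_ge0 (a g).
rewrite l1normE -fine_nnsumZ// fineK// nnsum_fin//.
  by move=> g; rewrite mulr_ge0.
exact: nnsumZ_lty.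
Qed.

Lemma l1_conv a b : l1 a -> l1 b -> l1 (Defs.conv w a b).
Proof.
move=> al1 bl1; have a0 g := cabs_ge0 (a g).
pose F k g := cabs (RtoC (Om g (g^-1 * k)%g) * a g * b (g^-1 * k)%g).
rewrite l1E; apply: (@le_lt_trans _ _ (\esum_(k in [set: G]) nnsum (F k))%E).
  apply: le_esum => k _; have kl1 := l1_conv_term k al1 bl1.
  apply: le_trans (_ : (l1norm (fun g =>
    RtoC (Om g (g^-1 * k)%g) * a g * b (g^-1 * k)%g))%:E <= _)%E.
    by rewrite lee_fin; exact: cabs_csum.
  by rewrite l1normE fineK// nnsum_fin// => g; exact: cabs_ge0.
rewrite nnsum_fubini; last by move=> k g; exact: cabs_ge0.
apply: le_lt_trans (nnsumZ_lty (l1norm_ge0 b) a0 al1).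
apply: le_esum => g _; rewrite mulrC -nnsum_cmul//.
rewrite -(@nnsum_reindex _ _ (fun k => g^-1 * k)%g (fun k => g * k)%g
  (fun h => cabs (a g) * cabs (b h))).
- apply: le_nnsum => k; rewrite /F !cabsM ler_wpM2r ?cabs_ge0//.
  by rewrite -[leRHS]mul1r ler_pM ?cabs_ge0// cabs_Omega_le1.
- by move=> h; rewrite mulVKg.
- by move=> h; rewrite mulKg.
Qed.

(** Exchanging the two sums and substituting [k = g * h] reduces the claim to the cocycle identity,
    term by term. *)
Lemma act_assoc a b : l1 a -> l1 b -> forall f,
  act (Defs.conv w a b) f = act a (act b f).
Proof.
move=> al1 bl1 f; apply: vfun_eq => x; have abl1 := l1_conv al1 bl1.
have a0 g := cabs_ge0 (a g).
rewrite !actE//; pose K := vnorm f.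
have fK y : cabs (f y) <= K by exact: cabs_le_vnorm.
have K0 : 0 <= K by exact: vnorm_ge0.
pose F k g := (RtoC (Om x.2 k) * f (rtrans k x)) *
  (RtoC (Om g (g^-1 * k)%g) * a g * b (g^-1 * k)%g).
have -> : act_fun (Defs.conv w a b) f x = csum (fun k => csum (F k)).
  congr csum; apply/funext => k; rewrite csumZ; last exact: l1_conv_term.
  by rewrite mulrC.
rewrite csum_fubini.
  congr csum; apply/funext => g.
  rewrite -(@csum_reindex _ _ (fun k => g * k)%g (fun k => g^-1 * k)%g); last 2 first.
  - by move=> h; rewrite mulKg.
  - by move=> h; rewrite mulVKg.
  rewrite actE// /act_fun mulrA -csumZ; last exact: l1_act.
  congr csum; apply/funext => h; rewrite /F /rtrans /= mulKg mulgA.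
  have e : RtoC (Om g h) * RtoC (Om x.2 (g * h)%g) =
      RtoC (Om x.2 g) * RtoC (Om (x.2 * g)%g h).
    by rewrite -!RtoCM Omega_cocycle.
  transitivity ((RtoC (Om g h) * RtoC (Om x.2 (g * h)%g)) * a g * b h *
    f (x.1, (x.2 * g * h)%g)).
    by ring.
  by rewrite e; ring.
(* Absolute convergence for the exchange: summed over [k] first, the terms for [g] are at most
   [K * l1norm b * cabs (a g)]. *)
rewrite (nnsum_fubini (F := fun k g => cabs (F k g))); last first.
  by move=> k g; exact: cabs_ge0.
have Kb0 : 0 <= K * l1norm b by rewrite mulr_ge0 ?l1norm_ge0.
apply: le_lt_trans (nnsumZ_lty Kb0 a0 al1).
apply: le_esum => g _.
have -> : K * l1norm b * cabs (a g) = K * cabs (a g) * l1norm b by ring.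
rewrite -nnsum_cmul ?mulr_ge0//.
rewrite -(@nnsum_reindex _ _ (fun k => g^-1 * k)%g (fun k => g * k)%g
  (fun h => K * cabs (a g) * cabs (b h))).
- apply: le_nnsum => k; rewrite /F cabsM [cabs (_ * b _)]cabsM mulrA ler_wpM2r ?cabs_ge0//.
  rewrite ler_pM ?cabs_ge0 ?cabs_act_coef// cabsM.
  by rewrite -[leRHS]mul1r ler_pM ?cabs_ge0// cabs_Omega_le1.
- by move=> h; rewrite mulVKg.
- by move=> h; rewrite mulKg.
Qed.

Lemma act_bound a : l1 a -> forall f, nrm (act a f) <= l1norm a * nrm f.
Proof.
move=> al1 f; rewrite !nrm_vfun vnorm_le ?mulr_ge0 ?l1norm_ge0 ?vnorm_ge0// => x.
by rewrite actE//; apply: act_fun_bound => // y; exact: cabs_le_vnorm.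
Qed.

Definition vmod : banach_lmod w :=
  @BanachLMod R G w (vfun R D) act act_linr act_linl act_assoc act_bound.

End Module.
End Weights.

(** * Phillips' lemma *)

Section Phillips.
Variables (R : realType) (T : choiceType).

Definition bounded_fct (f : T -> R) : Prop := exists K : R, forall x, `|f x| <= K.

Definition point_ind (r : T) : T -> R := fun x => (x == r)%:R.

Variables (Phi : T -> (T -> R) -> R) (M : R).
Hypothesis PhiD : forall r f g, bounded_fct f -> bounded_fct g ->
  Phi r (fun x => f x + g x) = Phi r f + Phi r g.
Hypothesis PhiN : forall r f, bounded_fct f -> Phi r (fun x => - f x) = - Phi r f.
Hypothesis Phi_le : forall r f, (forall x, `|f x| <= 1) -> Phi r f <= M.
Hypothesis Phi_cvg0 : forall f, bounded_fct f -> forall eps : R, 0 < eps ->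
  finite_set [set r | eps <= `|Phi r f|].

(* Split the sequence into infinitely many subsequences. If none of them works,
   each contains a bad index, and along the sequence of bad indices the
   variation has dropped by [eps]; this can happen only finitely often. *)
Lemma rosenthal (eps : R) (n : nat) (K : R) (e : nat -> T) : 0 < eps ->
  injective e -> K <= n%:R * eps ->
  (forall i f, (forall x, `|f x| <= 1) -> (forall x, ~ range e x -> f x = 0) ->
     Phi (e i) f <= K) ->
  exists e' : nat -> T, [/\ injective e', forall i, range e (e' i) &
    forall i f, (forall x, `|f x| <= 1) ->
      (forall x, ~ (exists2 j, j <> i & x = e' j) -> f x = 0) ->
      Phi (e' i) f <= eps].
Proof.
move=> eps0; elim: n K e => [|n IHn] K e einj Kn eK.
  exists e; split=> [//|i|i f f1 f0]; first by exists i.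
  apply: le_trans (_ : K <= _); last by apply: le_trans Kn _; rewrite mul0r ltW.
  by apply: eK => // x xe; apply: f0 => -[j _ xj]; apply: xe; exists j.
(* Coding pairs by integers cuts [e] into infinitely many disjoint subsequences [ep p]. *)
pose ep p i := e (@pickle (nat * nat)%type (p, i)).
have epinj p i q j : ep p i = ep q j -> (p, i) = (q, j).
  by move=> /einj; exact: (pcan_inj (@pickleK (nat * nat)%type)).
have [[p hp]|bad] := pselect (exists p, forall i f, (forall x, `|f x| <= 1) ->
    (forall x, ~ (exists2 j, j <> i & x = ep p j) -> f x = 0) ->
    Phi (ep p i) f <= eps).
  exists (ep p); split; [by move=> i j /epinj[]| |exact: hp].
  by move=> i; exists (@pickle (nat * nat)%type (p, i)).
have {}bad p : exists u : nat * (T -> R), [/\ forall x, `|u.2 x| <= 1,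
    forall x, ~ (exists2 j, j <> u.1 & x = ep p j) -> u.2 x = 0
    & eps < Phi (ep p u.1) u.2].
  apply: contrapT => nu; apply: bad; exists p => i f f1 f0.
  by rewrite leNgt; apply/negP => lt; apply: nu; exists (i, f).
have [u uP] := choice bad.
pose e1 p := ep p (u p).1.
have e1inj : injective e1 by move=> p q /epinj[].
have sub1 x : range e1 x -> range e x.
  by move=> [p _ <-]; exists (@pickle (nat * nat)%type (p, (u p).1)).
have [||e' [e'inj e'e1 e'P]] := IHn (K - eps) e1 e1inj.
- by move: Kn; rewrite -natr1 mulrDl mul1r; lra.
- move=> p f f1 f0; have [up1 up0 upe] := uP p.
  have bf : bounded_fct f by exists 1.
  have bu : bounded_fct (u p).2 by exists 1.
  (* The supports of [f] and [(u p).2] are disjoint: [e1] meets the subsequence [ep p] only at index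
     [(u p).1], where [(u p).2] vanishes. So the sum is still bounded by 1, and the excess [eps] of
     [(u p).2] leaves at most [K - eps] for [f]. *)
  have : Phi (e1 p) (fun x => f x + (u p).2 x) <= K.
    apply: eK => [x|x xe].
      have [[q _ <-]|/f0 ->] := pselect (range e1 x); last by rewrite add0r.
      rewrite up0 ?addr0// => -[j jp /epinj[qp]]; rewrite qp => uj.
      by apply: jp.
    rewrite f0 ?up0 ?addr0//; last by move=> /sub1.
    by move=> [j _ xj]; apply: xe; exists (@pickle (nat * nat)%type (p, j)).
  by rewrite PhiD//; move: upe; rewrite -/(e1 p); lra.
by exists e'; split=> // i; exact: sub1.
Qed.

(** If there were infinitely many such [r], [rosenthal] would extract a sequence along which the
    off-diagonal contribution is at most [eps / 2]. The indicator [f] of its range would then keep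
    [Phi (e' i) f] above [eps / 2] for every [i], against [Phi_cvg0]. *)
Lemma phillips (eps : R) : 0 < eps ->
  finite_set [set r | eps <= Phi r (point_ind r)].
Proof.
move=> eps0; apply: contrapT => /infiniteP/card_leP[f].
pose e i := val (f (to_setT i)).
have einj : injective e.
  by move=> i j /val_inj ij; have [] := 'inj_f (in_setT _) (in_setT _) ij.
have eA i : eps <= Phi (e i) (point_ind (e i)) by exact: set_valP (f (to_setT i)).
clearbody e; clear f.
have e20 : 0 < eps / 2 by lra.
have [|//||e' [e'inj e'e e'P]] := @rosenthal (eps / 2)
    (Num.truncn (`|M| / (eps / 2))).+1 `|M| e e20.
- exact: einj.
- by rewrite -ler_pdivrMr// ltW// truncnS_gt.
- by move=> i f f1 _; apply: le_trans (Phi_le _ f1) (ler_norm _).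
pose f x : R := `[< range e' x >]%:R.
have f1 x : `|f x| <= 1 by rewrite /f; case: asboolP; rewrite ?normr1 ?normr0.
have p1 r x : `|point_ind r x| <= 1.
  by rewrite /point_ind; case: eqP; rewrite ?normr1 ?normr0.
have bf : bounded_fct f by exists 1.
have bp r : bounded_fct (point_ind r) by exists 1.
have ef i : eps / 2 <= `|Phi (e' i) f|.
  apply: le_trans (ler_norm _).
  (* The off-diagonal part [g] is the indicator of the other terms. The extracted bound is
     one-sided, so it is applied to [- g] to bound [Phi] of [g] from below. *)
  pose g x := f x - point_ind (e' i) x.
  have gE x : g x = `[< exists2 j, j <> i & x = e' j >]%:R.
    rewrite /g /f /point_ind; have [->|xi] := eqVneq x (e' i).
      rewrite asboolT ?subrr; last by exists i.
      by rewrite asboolF// => -[j ji /e'inj ij]; apply: ji.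
    rewrite subr0; congr (nat_of_bool _)%:R; apply/asboolP/asboolP.
      by move=> [j _ jx]; exists j => // ji; rewrite -jx ji eqxx in xi.
    by move=> [j _ ->]; exists j.
  have g1 x : `|- g x| <= 1.
    by rewrite gE normrN; case: asboolP; rewrite ?normr1 ?normr0.
  have bg : bounded_fct g by exists 1 => x; rewrite -normrN.
  have := e'P i (fun x => - g x) g1.
  rewrite PhiN// => /(_ _)/wrap[x nx|ge]; first by rewrite gE asboolF ?oppr0.
  rewrite (_ : f = (fun x => point_ind (e' i) x + g x)); last first.
    by apply/funext => x; rewrite /g addrC subrK.
  have eAi : eps <= Phi (e' i) (point_ind (e' i)) by have [j _ <-] := e'e i.
  by rewrite PhiD//; move: ge eAi; lra.
have := Phi_cvg0 bf e20 => /(finite_preimage (f := e')).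
move=> /(_ (in2W e'inj)) fin.
apply: infinite_nat; apply: sub_finite_set fin => i _.
exact: ef.
Qed.

End Phillips.

(** * The embedding of c_0(G) in B(A, c_0(G)) *)

Section KernelClosed.
Variables (R : realType) (X : Type) (D : set (set X)).
Local Notation C := R[i].

(** A point [f] of the closure has zeros [g] of [L] arbitrarily near, and [L f = L (f - g)]. The
    range of [embed] and its complement are both intersections of such kernels. *)
Lemma closed_kernel (L : vfun R D -> C) (K : R) :
  (forall f g, L (f - g) = L f - L g) ->
  (forall f, cabs (L f) <= K * vnorm f) -> closed [set f | L f = 0].
Proof.
move=> LB LK f fcl; apply: cabs_eq0; apply/eqP; rewrite eq_le cabs_ge0 andbT.
apply/ler_addgt0Pr => e e0; rewrite add0r.
have d0 : 0 < e / (`|K| + 1) by rewrite divr_gt0// ltr_wpDl.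
have [g [/= Lg]] : [set f | L f = 0] `&` ball f (RtoC (e / (`|K| + 1))) !=set0.
  by apply: fcl; apply: nbhsx_ballx; rewrite RtoC_lt.
rewrite ball_vfun => fg.
have -> : L f = L (f - g) by rewrite LB Lg subr0.
apply: le_trans (LK _) _.
apply: le_trans (_ : (`|K| + 1) * (e / (`|K| + 1)) <= _); last first.
  by rewrite mulrC divfK// gt_eqF// ltr_wpDl.
apply: le_trans (_ : (`|K| + 1) * vnorm (f - g) <= _).
  by rewrite ler_wpM2r ?vnorm_ge0//; have := ler_norm K; lra.
by rewrite ler_wpM2l ?ltW//; have := normr_ge0 K; lra.
Qed.

End KernelClosed.

(** * Sums with a single nonzero term, and the action of point masses *)

Section SingleTerm.
Variables (R : realType) (G : groupType).
Local Notation C := R[i].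

Lemma nnsum_single (p : G -> R) (t : G) : 0 <= p t ->
  (forall g, g != t -> p g = 0) -> nnsum p = (p t)%:E.
Proof.
move=> pt0 p0; rewrite -(@esum_set1 _ _ t (fun g => (p g)%:E)) ?lee_fin//.
rewrite [RHS]esum_mkcond; apply: eq_esum => g _.
case: ifPn => // /negP ng; rewrite p0//; apply/eqP => gt.
by apply: ng; rewrite gt; exact/mem_set.
Qed.

Lemma rsum_single (f : G -> R) (t : G) : (forall g, g != t -> f g = 0) ->
  rsum f = f t.
Proof.
move=> f0; have single (u : R -> R) : 0 <= u (f t) -> u 0 = 0 ->
    (\esum_(g in [set: G]) (u (f g))%:E)%E = (u (f t))%:E.
  by move=> ut u0; apply: (@nnsum_single (fun g => u (f g))) => // g /f0 ->.
rewrite /rsum (single (Num.max^~ 0)) ?maxxx ?le_max ?lexx ?orbT//.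
rewrite (single (fun x => Num.max (- x) 0)) ?oppr0 ?maxxx ?le_max ?lexx ?orbT//=.
by case: leP => h1; case: leP => h2; lra.
Qed.

Lemma csum_single (a : G -> C) (t : G) : (forall g, g != t -> a g = 0) ->
  csum a = a t.
Proof.
move=> a0; apply: ReIm_eq; rewrite /csum /=.
  by apply: (rsum_single (f := fun g => complex.Re (a g))) => g /a0 ->.
by apply: (rsum_single (f := fun g => complex.Im (a g))) => g /a0 ->.
Qed.

Lemma l1_delta (g : G) : l1 (delta R g).
Proof.
rewrite l1E (nnsum_single (t := g)) ?ltry ?cabs_ge0// => h hg.
by rewrite /delta (negbTE hg) cabs0.
Qed.

Variable w : G -> R.

Lemma conv_deltal (t s : G) (a : G -> C) :
  Defs.conv w (delta R t) a s = RtoC (Omega w t (t^-1 * s)%g) * a (t^-1 * s)%g.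
Proof.
rewrite /Defs.conv (@csum_single _ t).
  by rewrite /delta eqxx mulr1.
by move=> g gt; rewrite /delta (negbTE gt) mulr0 mul0r.
Qed.

Lemma dual_actE (a mu : G -> C) (t : G) :
  dual_act w a mu t = csum (fun h => a h * (RtoC (Omega w t h) * mu (t * h)%g)).
Proof.
rewrite -(@csum_reindex _ _ (fun s => t^-1 * s)%g (fun h => t * h)%g).
- congr csum; apply/funext => s; rewrite conv_deltal mulVKg.
  by ring.
- by move=> h; rewrite mulVKg.
- by move=> h; rewrite mulKg.
Qed.

Lemma dual_act_delta (h t : G) (mu : G -> C) :
  dual_act w (delta R h) mu t = RtoC (Omega w t h) * mu (t * h)%g.
Proof.
rewrite dual_actE (@csum_single _ h).
  by rewrite /delta eqxx mul1r.
by move=> g gh; rewrite /delta (negbTE gh) mul0r.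
Qed.

End SingleTerm.

(** * The two modules and the complemented embedding between them *)

Section C0Embedding.
Variables (R : realType) (G : groupType) (w : G -> R).
Hypothesis weight_w : is_weight w.
Local Notation C := R[i].
Local Notation Om g h := (RtoC (Omega w g h)).

(** The dummy factor [unit] makes [c_0(G)] an instance of functions on [T * G]. *)
Definition c0_family : set (set (unit * G)) := [set setT].

Definition hom_family : set (set (G * G)) :=
  [set S | exists g, S = [set x | x.2 = g]].

Lemma c0_family_rtrans S h : c0_family S -> c0_family (rtrans h @` S).
Proof.
move=> ->; apply/seteqP; split=> // -[[] g] _.
by exists (tt, g * h^-1)%g => //; rewrite /rtrans /= mulgVK.
Qed.

Lemma hom_family_rtrans S h : hom_family S -> hom_family (rtrans h @` S).
Proof.
move=> [g ->]; exists (g * h)%g; apply/seteqP; split=> [_ [[t s] /= -> <-]//|].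
by move=> [t s] /= ->; exists (t, g).
Qed.

Definition c0_mod : banach_lmod w := vmod weight_w c0_family_rtrans.

(* [hom_mod] is B(A, c0(G)) with (a . phi)(b) = phi(b * a); an operator [phi] is
   encoded by the bounded function (t, g) |-> phi(delta_g)(t). *)
Definition hom_mod : banach_lmod w := vmod weight_w hom_family_rtrans.

Let cF := vfun R c0_family.
Let hF := vfun R hom_family.

(** This encodes the operator [a |-> a . x]: its value at [delta g] is [delta g . x], which at [t]
    equals [Omega w t g * x (t * g)]. *)
Definition embed_fun (x : cF) (y : G * G) : C :=
  Om y.1 y.2 * x (tt, (y.1 * y.2)%g).

Lemma embed_vanishing x : vanishing hom_family (embed_fun x).
Proof.
have le_x y : cabs (embed_fun x y) <= cabs (x (tt, (y.1 * y.2)%g)).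
  by rewrite cabsM -[leRHS]mul1r ler_pM ?cabs_ge0// cabs_Omega_le1.
split; first by exists (vnorm x) => y; rewrite (le_trans (le_x y)) ?cabs_le_vnorm.
move=> _ [g ->] eps eps0; have [_ /(_ setT erefl eps eps0) xfin] := vfunP x.
apply: sub_finite_set (finite_image (fun y => (y.2 * g^-1, g)%g) xfin).
move=> [t h] [/= -> le_eps]; exists (tt, t * g)%g; last by rewrite /= mulgK.
by split=> //; exact: le_trans le_eps (le_x _).
Qed.

Definition embed (x : c0_mod) : hom_mod := to_vfun hom_family (embed_fun x).

Lemma embedE x y : (embed x : hF) y = embed_fun x y.
Proof. by rewrite to_vfunE//; exact: embed_vanishing. Qed.

Lemma embed_linear : is_linear embed.
Proof.
move=> c x y; apply: vfun_eq => z.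
rewrite vfunDE vfunZE !embedE /embed_fun vfunDE vfunZE.
by ring.
Qed.

Lemma embed_bounded : bounded_map embed.
Proof.
exists 1 => x; rewrite mul1r !nrm_vfun vnorm_le ?vnorm_ge0// => y.
rewrite embedE cabsM -[leRHS]mul1r ler_pM ?cabs_ge0//.
  exact: cabs_Omega_le1.
exact: cabs_le_vnorm.
Qed.

Lemma embed_hom : is_lmod_hom embed.
Proof.
move=> a al1 x; apply: vfun_eq => -[t g].
change ((embed (act w a (x : cF)) : hF) (t, g) = act w a (embed x : hF) (t, g)).
rewrite embedE /embed_fun !actE//; try exact: hom_family_rtrans; try exact: c0_family_rtrans.
rewrite /act_fun.
rewrite -csumZ; last exact: l1_act.
congr csum; apply/funext => h; rewrite embedE /embed_fun /rtrans /=.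
have e : Om g h * Om t (g * h)%g = Om t g * Om (t * g)%g h.
  by rewrite -!RtoCM Omega_cocycle.
transitivity ((Om t g * Om (t * g)%g h) * a h * x (tt, (t * g * h)%g)); first by ring.
by rewrite -e mulgA; ring.
Qed.

Lemma embed_at1 x t : (embed x : hF) (t, 1%g) = x (tt, t).
Proof. by rewrite embedE /embed_fun /= mulg1 Omega_1// mul1r. Qed.

Lemma embed_inj : injective embed.
Proof.
move=> x y xy; apply: vfun_eq => -[[] t].
by rewrite -!embed_at1 xy.
Qed.

Definition at1_fun (phi : hF) (y : unit * G) : C := phi (y.2, 1%g).

Lemma at1_vanishing phi : vanishing c0_family (at1_fun phi).
Proof.
split; first by exists (vnorm phi) => y; exact: cabs_le_vnorm.
move=> _ -> eps eps0; have [_ hphi] := vfunP phi.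
have phifin : finite_set [set y | y.2 = 1%g /\ eps <= cabs (phi y)].
  by apply: (hphi [set y | y.2 = 1%g]) => //; exists 1%g.
apply: sub_finite_set (finite_image (fun y => (tt, y.1)) phifin).
by move=> [[] t] [_ le_eps]; exists (t, 1%g).
Qed.

Lemma range_embedE : range embed =
  \bigcap_(y in [set: G * G])
    [set phi : hF | phi y - Om y.1 y.2 * phi ((y.1 * y.2)%g, 1%g) = 0].
Proof.
apply/seteqP; split=> [_ [x _ <-] y _ /=|phi phiP].
  by rewrite embed_at1 embedE subrr.
exists (to_vfun c0_family (at1_fun phi)) => //; apply: vfun_eq => y.
rewrite embedE /embed_fun to_vfunE; last exact: at1_vanishing.
by apply/esym/subr0_eq/phiP.
Qed.

(** Restriction to the points [(t, 1)], that is, evaluation of the operator at the unit, is a left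
    inverse of [embed]. Its kernel is the complement. *)
Lemma embed_closed_complemented : closed_complemented (range embed).
Proof.
split.
  rewrite range_embedE; apply: closed_bigI => -[t g] _ /=.
  apply: (@closed_kernel _ _ _ _ 2) => [f h|f].
    by rewrite !vfunBE; ring.
  apply: le_trans (cabsD _ _) _; rewrite cabsN cabsM.
  rewrite (_ : 2 * vnorm f = vnorm f + 1 * vnorm f); last by ring.
  by rewrite lerD ?cabs_le_vnorm// ler_pM ?cabs_ge0 ?cabs_le_vnorm ?cabs_Omega_le1.
exists (\bigcap_(t in [set: G]) [set phi : hF | phi (t, 1%g) = 0]); split.
- by [].
- move=> c x y x0 y0 t _ /=.
  move: (x0 t I) (y0 t I) => /= xt yt.
  change (c * (x : hF) (t, 1%g) + (y : hF) (t, 1%g) = 0).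
  by rewrite xt yt mulr0 addr0.
- apply: closed_bigI => t _; apply: (@closed_kernel _ _ _ _ 1) => [//|f].
  by rewrite mul1r cabs_le_vnorm.
- move=> _ [[x _ <-] x0]; apply: vfun_eq => y.
  rewrite embedE /embed_fun -embed_at1 (x0 (y.1 * y.2)%g I) mulr0.
  by [].
- move=> phi; pose x : c0_mod := to_vfun c0_family (at1_fun phi).
  exists (embed x), (phi - embed x); split; [by exists x| |by rewrite addrC subrK].
  move=> t _.
  change ((phi : hF) (t, 1%g) - (embed x : hF) (t, 1%g) = 0).
  rewrite embed_at1 to_vfunE ?subrr//.
  exact: at1_vanishing.
Qed.

Definition c0_incl (x : c0_mod) : G -> C := fun t => (x : cF) (tt, t).

Lemma c0_incl_c0 x : c0 (c0_incl x).
Proof.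
move=> eps eps0; have [_ /(_ setT erefl eps eps0) xfin] := vfunP (x : cF).
apply: sub_finite_set (finite_image (fun y => y.2) xfin).
by move=> t /= le_eps; exists (tt, t).
Qed.

Lemma c0_incl_hom a x : l1 a -> c0_incl (bl_act a x) = dual_act w a (c0_incl x).
Proof.
move=> al1; apply/funext => t; rewrite dual_actE.
change (act w a (x : cF) (tt, t) = csum (fun h => a h * (Om t h * (x : cF) (tt, (t * h)%g)))).
by rewrite actE//; exact: c0_family_rtrans.
Qed.

Lemma supnorm_c0_incl x : supnorm (c0_incl x) <= nrm x.
Proof.
apply: ge_sup => [|_ [t _ <-]]; first by exists (cabs (c0_incl x 1%g)), 1%g.
exact: (cabs_le_vnorm (x : cF)).
Qed.

End C0Embedding.

(** The supremum is meaningful only for a bounded function; boundedness holds since only finitely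
    many values have modulus at least 1, and their sum plus 1 is an upper bound. *)
Lemma c0_cabs_le_supnorm (R : realType) (G : groupType) (f : G -> R[i]) (g : G) :
  c0 f -> cabs (f g) <= supnorm f.
Proof.
move=> f0; apply: ub_le_sup; last by exists g.
have [A AE] := (finite_seqP _).1 (f0 1 ltr01).
have A0 : 0 <= \sum_(h <- A) cabs (f h) by apply: sumr_ge0 => h _; exact: cabs_ge0.
exists (1 + \sum_(h <- A) cabs (f h)) => _ [h _ <-].
have [le1|lt1] := leP 1 (cabs (f h)); last first.
  by apply: le_trans (ltW lt1) _; rewrite lerDl.
have hA : h \in A by have : [set` A] h by rewrite -AE.
rewrite (big_rem h)//= addrCA lerDl addr_ge0// sumr_ge0// => k _.
exact: cabs_ge0.
Qed.

(** * Non-existence of a retraction *)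

Section NoRetraction.
Variables (R : realType) (G : groupType) (w : G -> R).
Hypothesis weight_w : is_weight w.
Hypothesis infinite_G : infinite_set [set: G].
Variable N : G -> nat.
Hypothesis N_inj : injective N.
Local Notation C := R[i].
Local Notation Om g h := (RtoC (Omega w g h)).
Local Notation hF := (vfun R (@hom_family G)).

Variable rho : hom_mod weight_w -> G -> C.
Hypothesis rho_linear : is_linear rho.
Hypothesis rho_c0 : forall y, c0 (rho y).
Variable M : R.
Hypothesis rho_bounded : forall (y : hF) r, cabs (rho y r) <= M * vnorm y.
Hypothesis rho_hom : forall a, l1 a -> forall y : hF,
  rho (act w a y) = dual_act w a (rho y).
Hypothesis rho_embed : forall x : vfun R (@c0_family G),
  rho (@embed R G w weight_w x) = fun t => x (tt, t).

Lemma finite_N_lt n : finite_set [set g | (N g < n)%N].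
Proof.
apply: (@sub_finite_set _ _ (N @^-1` `I_n)) => //.
by apply: finite_preimage => // g h _ _; exact: N_inj.
Qed.

Lemma rhoD (x y : hF) r : rho (x + y) r = rho x r + rho y r.
Proof.
have := rho_linear 1 x y; rewrite scale1r => /(congr1 (fun f => f r)) ->.
by rewrite /= -[LHS]/(1 * rho x r + rho y r) mul1r.
Qed.

Lemma rho0 r : rho (0 : hF) r = 0.
Proof. by apply: (addrI (rho 0 r)); rewrite -rhoD !addr0. Qed.

Lemma rhoZ (c : C) (x : hF) r : rho (c *: x) r = c * rho x r.
Proof.
have := rho_linear c x 0; rewrite addr0 => /(congr1 (fun f => f r)) ->.
by rewrite -[LHS]/(c * rho x r + rho 0 r) rho0 addr0.
Qed.

(* The cut-off [cut] makes the lift of an arbitrary bounded [f] belong to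
   [hom_family], while for fixed [r] only finitely many [t] satisfy
   [~~ cut t (t^-1 * r)]. *)
Definition cut (t g : G) : bool := (minn (N t) (N (t * g)%g) < N g)%N.

Definition lift_fun (f : G -> R) (y : G * G) : C :=
  if cut y.1 y.2 then Om y.1 y.2 * RtoC (f (y.1 * y.2)%g) else 0.

Lemma cabs_lift_fun (f : G -> R) (K : R) y : (forall x, `|f x| <= K) ->
  cabs (lift_fun f y) <= K.
Proof.
move=> fK; rewrite /lift_fun; case: ifP => _.
  by rewrite cabsM -[K]mul1r ler_pM ?cabs_ge0 ?cabs_Omega_le1// cabs_RtoC.
by rewrite cabs0 (le_trans _ (fK 1%g)).
Qed.

Lemma lift_vanishing f : bounded_fct f -> vanishing (@hom_family G) (lift_fun f).
Proof.
move=> [K fK]; split; first by exists K => y; exact: cabs_lift_fun.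
move=> _ [g ->] eps eps0; have finN := finite_N_lt (N g).
apply: (@sub_finite_set _ _ ((fun t => (t, g)) @` [set t | (N t < N g)%N] `|`
    (fun u => (u * g^-1, g)%g) @` [set u | (N u < N g)%N])); last first.
  by rewrite finite_setU; split; exact: finite_image.
move=> [t h] [/= -> ]; rewrite /lift_fun /=; case: ifP => [ct _|_]; last first.
  by rewrite cabs0 leNgt eps0.
(* For fixed [g], the cut-off confines [t] or [t * g] to a finite sublevel set of [N]. *)
move: ct; rewrite /cut gtn_min => /orP[lt|lt]; [left|right].
  by exists t.
by exists (t * g)%g; rewrite ?mulgK.
Qed.

Definition lift (f : G -> R) : hF := to_vfun (@hom_family G) (lift_fun f).

Lemma liftE f y : bounded_fct f -> lift f y = lift_fun f y.
Proof. by move=> fb; rewrite to_vfunE//; exact: lift_vanishing. Qed.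

Lemma bounded_fctD (f g : G -> R) : bounded_fct f -> bounded_fct g ->
  bounded_fct (fun x => f x + g x).
Proof.
move=> [K fK] [L gL]; exists (K + L) => x.
by apply: le_trans (ler_normD _ _) _; rewrite lerD.
Qed.

Lemma bounded_fctN (f : G -> R) : bounded_fct f -> bounded_fct (fun x => - f x).
Proof. by move=> [K fK]; exists K => x; rewrite normrN. Qed.

Lemma liftD f g : bounded_fct f -> bounded_fct g ->
  lift (fun x => f x + g x) = lift f + lift g.
Proof.
move=> bf bg; apply: vfun_eq => y; rewrite vfunDE !liftE//; last exact: bounded_fctD.
by rewrite /lift_fun; case: ifP => _; rewrite ?addr0// RtoCD mulrDr.
Qed.

Lemma liftN f : bounded_fct f -> lift (fun x => - f x) = -1 *: lift f.
Proof.
move=> bf; apply: vfun_eq => y; rewrite vfunZE !liftE//; last exact: bounded_fctN.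
rewrite /lift_fun; case: ifP => _; last by rewrite mulr0.
by rewrite (_ : RtoC (- _) = - RtoC (f (y.1 * y.2)%g)) ?mulrN ?mulN1r//
  /RtoC; apply: ReIm_eq; rewrite //= oppr0.
Qed.

Definition rho_lift (r : G) (f : G -> R) : R := complex.Re (rho (lift f) r).

Lemma rho_lift_point_ind (eps : R) : 0 < eps ->
  finite_set [set r | eps <= rho_lift r (point_ind R r)].
Proof.
apply: (@phillips R G rho_lift `|M|).
- by move=> r f g bf bg; rewrite /rho_lift liftD// rhoD ReD.
- by move=> r f bf; rewrite /rho_lift liftN// rhoZ mulN1r ReN.
- move=> r f f1; apply: le_trans (ler_norm _) _.
  apply: le_trans (normRe_le_cabs _) _; apply: le_trans (rho_bounded _ _) _.
  apply: le_trans (ler_wpM2r (vnorm_ge0 _) (ler_norm M)) _.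
  rewrite ler_piMr// vnorm_le// => y; rewrite liftE; last by exists 1.
  exact: cabs_lift_fun.
- move=> f bf eps' eps'0; have := rho_c0 (lift f) eps'0.
  by apply: sub_finite_set => r /= h; apply: le_trans h (normRe_le_cabs _).
Qed.

(** With [c] constantly 1 this is the image under [embed] of the point mass at [r]; in general [c]
    weights its values along the curve [t * g = r]. *)
Definition slice_fun (c : G -> R) (r : G) (y : G * G) : C :=
  if (y.1 * y.2)%g == r then Om y.1 y.2 * RtoC (c y.1) else 0.

Lemma cabs_slice_fun (c : G -> R) (K : R) r y : (forall x, `|c x| <= K) ->
  cabs (slice_fun c r y) <= K.
Proof.
move=> cK; rewrite /slice_fun; case: ifP => _.
  by rewrite cabsM -[K]mul1r ler_pM ?cabs_ge0 ?cabs_Omega_le1// cabs_RtoC.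
by rewrite cabs0 (le_trans _ (cK 1%g)).
Qed.

Lemma slice_vanishing c r : bounded_fct c ->
  vanishing (@hom_family G) (slice_fun c r).
Proof.
move=> [K cK]; split; first by exists K => y; exact: cabs_slice_fun.
move=> _ [g ->] eps eps0.
apply: (@sub_finite_set _ _ [set (r * g^-1, g)%g]); last exact: finite_set1.
move=> [t h] [/= ->]; rewrite /slice_fun /=; case: eqP => [<- _|_].
  by rewrite mulgK.
by rewrite cabs0 leNgt eps0.
Qed.

Definition slice (c : G -> R) (r : G) : hF :=
  to_vfun (@hom_family G) (slice_fun c r).

Lemma sliceE c r y : bounded_fct c -> slice c r y = slice_fun c r y.
Proof. by move=> cb; rewrite to_vfunE//; exact: slice_vanishing. Qed.

(* [slice c r] is a scalar multiple of a translate of [slice c 1]. *)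
Lemma rho_slice c r : bounded_fct c -> rho (slice c r) r = rho (slice c 1%g) 1%g.
Proof.
move=> bc; have Om0 : Om r r^-1%g != 0.
  apply/eqP => /(@RtoC_inj R _ 0); apply/eqP.
  by rewrite gt_eqF// Omega_gt0.
have E : act w (delta R r^-1%g) (slice c 1%g) = Om r r^-1%g *: slice c r.
  apply: vfun_eq => -[t g]; rewrite vfunZE actE//; last 2 first.
  - exact: hom_family_rtrans.
  - exact: l1_delta.
  rewrite /act_fun (@csum_single _ _ _ r^-1%g); last first.
    by move=> h hr; rewrite /delta (negbTE hr) mul0r.
  rewrite /delta eqxx mul1r !sliceE// /slice_fun /rtrans /=.
  rewrite mulgA -(inj_eq (@mulIg G r)) mulgVK mul1g.
  case: eqP => [tg|_]; last by rewrite !mulr0.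
  have e : Om g r^-1%g * Om t (g * r^-1)%g = Om t g * Om r r^-1%g.
    by rewrite -!RtoCM Omega_cocycle// tg.
  by rewrite mulrA e; ring.
(* Evaluating the dual action of [delta r^-1] at [r] produces the same nonzero scalar
   [Omega w r r^-1] as in [E], so it cancels. *)
apply: (mulfI Om0); rewrite -rhoZ -E rho_hom; last exact: l1_delta.
by rewrite dual_act_delta mulgV.
Qed.

(** On indicators this is the finitely additive [m] of the overview. *)
Definition unit_mass (c : G -> R) : R := complex.Re (rho (slice c 1%g) 1%g).

Lemma unit_massD c d : bounded_fct c -> bounded_fct d ->
  unit_mass (fun t => c t + d t) = unit_mass c + unit_mass d.
Proof.
move=> bc bd; rewrite /unit_mass -ReD -rhoD; congr (complex.Re (rho _ _)).
apply: vfun_eq => y; rewrite vfunDE !sliceE//; last exact: bounded_fctD.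
by rewrite /slice_fun; case: ifP => _; rewrite ?addr0// RtoCD mulrDr.
Qed.

Lemma unit_mass_le c : (forall t, `|c t| <= 1) -> unit_mass c <= `|M|.
Proof.
move=> c1; apply: le_trans (ler_norm _) _.
apply: le_trans (normRe_le_cabs _) _; apply: le_trans (rho_bounded _ _) _.
apply: le_trans (ler_wpM2r (vnorm_ge0 _) (ler_norm M)) _.
rewrite ler_piMr// vnorm_le// => y; rewrite sliceE; last by exists 1.
exact: cabs_slice_fun.
Qed.

Definition uncut (r : G) : set G := [set t | ~~ cut t (t^-1 * r)%g].

(** The two halves of the minimum serve separately: [N (t^-1 * r) <= N r] leaves finitely many [t]
    for each [r], and [N (t^-1 * r) <= N t] leaves finitely many [r] for each [t]. *)
Lemma uncutE r t : uncut r t <-> (N (t^-1 * r)%g <= minn (N t) (N r))%N.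
Proof. by rewrite /uncut /cut /= mulVKg -leqNgt. Qed.

Lemma finite_uncut r : finite_set (uncut r).
Proof.
apply: sub_finite_set (finite_image (fun u => r * u^-1)%g (finite_N_lt (N r).+1)).
move=> t /uncutE; rewrite leq_min => /andP[_ le_r].
by exists (t^-1 * r)%g; rewrite /= ?ltnS// invgM invgK mulVKg.
Qed.

Lemma finite_uncut_at t : finite_set [set r | uncut r t].
Proof.
apply: sub_finite_set (finite_image (fun u => t * u)%g (finite_N_lt (N t).+1)).
move=> r /uncutE; rewrite leq_min => /andP[le_t _].
by exists (t^-1 * r)%g; rewrite /= ?ltnS// mulVKg.
Qed.

Definition set_ind (A : set G) (t : G) : R := (t \in A)%:R.

Lemma set_ind_le1 A t : `|set_ind A t| <= 1.
Proof. by rewrite /set_ind; case: (_ \in _); rewrite ?normr1 ?normr0. Qed.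

Lemma bounded_set_ind A : bounded_fct (set_ind A).
Proof. by exists 1; exact: set_ind_le1. Qed.

(** The image of the point mass at [r] is its lift plus the slice over [uncut r], the part removed
    by the cut-off. The retraction takes the image to 1 at [r], and the slice to a mass independent
    of [r]. *)
Lemma rho_lift_uncut r :
  rho_lift r (point_ind R r) = 1 - unit_mass (set_ind (uncut r)).
Proof.
have bp : bounded_fct (point_ind R r).
  by exists 1 => x; rewrite /point_ind; case: eqP; rewrite ?normr1 ?normr0.
have bu := bounded_set_ind (uncut r).
pose dr : vfun R (@c0_family G) :=
  to_vfun (@c0_family G) (fun y => RtoC (point_ind R r y.2)).
have drE y : dr y = RtoC (point_ind R r y.2).
  rewrite to_vfunE//; split.
    exists 1 => z; rewrite cabs_RtoC /point_ind.
    by case: eqP; rewrite ?normr1 ?normr0.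
  move=> _ -> eps eps0; apply: (@sub_finite_set _ _ [set (tt, r)]); last first.
    exact: finite_set1.
  move=> [[] t] [_ /=]; rewrite /point_ind; case: eqP => [->//|_].
  by rewrite cabs_RtoC normr0 leNgt eps0.
have E : @embed R G w weight_w dr = lift (point_ind R r) + slice (set_ind (uncut r)) r.
  apply: vfun_eq => -[t g]; rewrite vfunDE embedE /embed_fun liftE// sliceE//.
  rewrite drE /lift_fun /slice_fun /point_ind /=.
  have [tg|tg] := eqVneq (t * g)%g r; last first.
    by rewrite (mulr0 (Om t g)) addr0; case: ifP; rewrite ?mulr0.
  rewrite /set_ind /uncut -tg.
  have -> : (t \in [set t0 | ~~ cut t0 (t0^-1 * (t * g))%g]) = ~~ cut t g.
    by apply/idP/idP => [/set_mem|h]; [|apply/mem_set]; rewrite /= mulKg.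
  by case: ifP; rewrite ?(mulr0 (Om t g)) ?addr0 ?add0r.
have := congr1 (fun y => complex.Re (rho y r)) E.
rewrite rho_embed drE rhoD ReD rho_slice// -/(unit_mass _) -/(rho_lift _ _).
by rewrite /point_ind eqxx /=; lra.
Qed.

(* Since every point lies in only finitely many of the finite sets [uncut r],
   infinitely many of them of mass at least 1/2 include a disjoint sequence. *)
Lemma unit_mass_unbounded n :
  exists2 B : set G, finite_set B & n%:R / 2 <= unit_mass (set_ind B).
Proof.
elim: n => [|n [B finB hB]].
  exists set0; first exact: finite_set0.
  have := unit_massD (bounded_set_ind set0) (bounded_set_ind set0).
  rewrite (_ : (fun t => _) = set_ind set0); last first.
    by apply/funext => t; rewrite /set_ind in_set0 addr0.
  by lra.
have fin1 := rho_lift_point_ind (_ : 0 < 1 / 2 :> R).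
have fin2 : finite_set (\bigcup_(t in B) [set r | uncut r t]).
  by apply: bigcup_finite => // t _; exact: finite_uncut_at.
have half0 : 0 < 1 / 2 :> R by lra.
(* Outside a finite set of exceptions, [uncut r] has mass above 1/2 and is disjoint from [B];
   infinitude of the group supplies such an [r]. *)
have [r nr] : exists r, ~ ([set r | 1 / 2 <= rho_lift r (point_ind R r)] `|`
    \bigcup_(t in B) [set r | uncut r t]) r.
  apply: contrapT => nr; apply: infinite_G.
  have fin12 : finite_set ([set r | 1 / 2 <= rho_lift r (point_ind R r)] `|`
      \bigcup_(t in B) [set r | uncut r t]).
    by rewrite finite_setU; split=> //; exact: fin1.
  apply: sub_finite_set fin12 => r _; apply: contrapT => nr'.
  by apply: nr; exists r.
have lt_r : rho_lift r (point_ind R r) < 1 / 2.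
  by rewrite ltNge; apply/negP => h; apply: nr; left.
have disj t : B t -> ~ uncut r t by move=> Bt ut; apply: nr; right; exists t.
exists (B `|` uncut r).
  by rewrite finite_setU; split=> //; exact: finite_uncut.
rewrite (_ : set_ind _ = (fun t => set_ind B t + set_ind (uncut r) t)).
  rewrite unit_massD; [|exact: bounded_set_ind..].
  move: lt_r; rewrite rho_lift_uncut -[n.+1%:R]natr1.
  by move: hB; lra.
apply/funext => t; rewrite /set_ind in_setU.
have [/set_mem/disj nu|_] := boolP (t \in B); last by rewrite add0r.
by rewrite memNset// addr0.
Qed.

Lemma no_retraction : False.
Proof.
(* This [n] is chosen so that [n / 2] exceeds the uniform bound on [unit_mass]. *)
pose n := (Num.truncn (2 * `|M|)).+1.
have [B _ hB] := unit_mass_unbounded n.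
have := unit_mass_le (set_ind_le1 B).
have : 2 * `|M| < n%:R by rewrite truncnS_gt.
by move: hB; lra.
Qed.

End NoRetraction.

Theorem theorem5p23 (R : realType) (G : groupType) (w : G -> R) :
  countable [set: G] -> ~ finite_set [set: G] ->
  is_weight w -> ~ strongly_non_amenable w ->
  ~ left_injective_mod w (@c0 R G) (@supnorm R G) (dual_act w).
Proof.
move=> /countable_injP[N N_inj] infG weight_w _ inj_c0.
(* Extending [c0_incl] along [embed] by left-injectivity yields the retraction [rho]. *)
have [|||rho [rho_lin rho_c0 [M rho_bd] rho_hom rho_embed]] :=
  inj_c0 (c0_mod weight_w) (hom_mod weight_w) (@embed _ _ _ weight_w)
    (@c0_incl _ _ _ weight_w) (@embed_linear _ _ _ weight_w) (@embed_bounded _ _ _ weight_w)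
    (@embed_hom _ _ _ weight_w) (@embed_inj _ _ _ weight_w)
    (embed_closed_complemented weight_w) _ (@c0_incl_c0 _ _ _ weight_w).
- by [].
- by exists 1 => x; rewrite mul1r supnorm_c0_incl.
- by move=> a al1 x; exact: c0_incl_hom.
apply: (@no_retraction R G w weight_w infG N _ rho rho_lin rho_c0 M _ rho_hom).
- by move=> g h; apply: N_inj; rewrite inE.
- move=> y r; apply: le_trans (c0_cabs_le_supnorm r (rho_c0 y)) _.
  exact: rho_bd.
- exact: rho_embed.
Qed.
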